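(* Let $X$ be a locally 1-connected metric space and let $A_1,A_2,\dots,A_n$ be disjoint connected, locally path connected and compact subspaces of $X$. Let $p:X\to X/(A_1,A_2,\dots,A_n)$ be the quotient map. Then for each $a\in\bigcup_{i=1}^n A_i$, with $*=p(a)$, the continuous homomorphism $$p_*:\pi_1^{qtop}(X,a)\longrightarrow \pi_1^{qtop}(X/(A_1,A_2,\dots,A_n),* )$$ induced by $p$ is an epimorphism (i.e. surjective).
   Context: For pairwise disjoint subspaces $A_1,\dots,A_n$ of a topological space $X$, $X/(A_1,\dots,A_n)$ denotes the quotient space (with the quotient topology) obtained from $X$ by identifying each of the sets $A_i$ to a point (a separate point for each $i$). A topological space $Y$ is locally 1-connected if it is locally path connected and locally simply connected, where locally simply connected means: for every $y\in Y$ and every open neighborhood $U$ of $y$ there is an open neighborhood $V\subseteq U$ of $y$ such that every loop in $V$ is nullhomotopic (relative to endpoints) in $U$. The quasitopological fundamental group $\pi_1^{qtop}(Y,y)$ is the usual fundamental group $\pi_1(Y,y)$ endowed with the quotient topology with respect to the canonical map $\Omega(Y,y)\to\pi_1(Y,y)$ sending a loop to its homotopy class, where the loop space $\Omega(Y,y)$ has the compact-open topology. Based continuous maps induce continuous homomorphisms of quasitopological fundamental groups. *)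

(* Defs.v *)
From HB Require Import structures.
From mathcomp Require Import all_boot all_order all_algebra generic_quotient.
From mathcomp Require Import ring lra.
From mathcomp Require Import all_classical all_reals all_analysis.
From mathcomp Require Import homotopy.
Import Order.TTheory GRing.Theory Num.Theory.
Import numFieldTopology.Exports numFieldNormedType.Exports.

Set Implicit Arguments.
Unset Strict Implicit.
Unset Printing Implicit Defensive.

Local Open Scope classical_set_scope.
Local Open Scope ring_scope.
Local Open Scope quotient_scope.

Definition unitI (R : realType) : Type := set_type [set` `[(0 : R), 1]].

Section unitI.
Context {R : realType}.
Local Notation I := (unitI R).

HB.instance Definition _ := Choice.copy I (set_type [set` `[(0 : R), 1]]).
HB.instance Definition _ := Topological.copy I (set_type [set` `[(0 : R), 1]]).

Definition unitI_val (s : I) : R := set_val s.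

Lemma clampI_subproof (x : R) :
  Num.max 0 (Num.min x 1) \in [set` `[(0 : R), 1]].
Proof. by rewrite inE /= in_itv /= le_max lexx /= ge_max ler01 ge_min lexx orbT. Qed.

Definition clampI (x : R) : I :=
  @exist R (fun y => y \in [set` `[(0 : R), 1]]) _ (clampI_subproof x).

Lemma clampI_valE x : unitI_val (clampI x) = Num.max 0 (Num.min x 1).
Proof. by []. Qed.

Lemma unitI_val_inj : injective unitI_val.
Proof. exact: val_inj. Qed.

Lemma unitI_val_ge0 s : 0 <= unitI_val s.
Proof.
by case: s => x xP; rewrite /unitI_val set_valE /=; move: xP; rewrite inE /= in_itv /= => /andP[].
Qed.

Lemma unitI_val_le1 s : unitI_val s <= 1.
Proof.
by case: s => x xP; rewrite /unitI_val set_valE /=; move: xP; rewrite inE /= in_itv /= => /andP[].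
Qed.

Lemma clampI_id x : 0 <= x -> x <= 1 -> unitI_val (clampI x) = x.
Proof. by move=> x0 x1; rewrite clampI_valE min_l// max_r. Qed.

Lemma unitI_valK : cancel unitI_val clampI.
Proof.
move=> s; apply: unitI_val_inj.
by rewrite clampI_id // ?unitI_val_ge0 ?unitI_val_le1.
Qed.

Lemma unitI01_neq : clampI 0 != clampI 1.
Proof.
apply/eqP => /(congr1 unitI_val).
by rewrite !clampI_id ?lexx ?ler01// => /esym/eqP; rewrite oner_eq0.
Qed.

(* Makes [zero] and [one] the endpoints 0 and 1. *)
HB.instance Definition _ := isBiPointed.Build I unitI01_neq.

Lemma clampI0 : clampI 0 = zero. Proof. by []. Qed.
Lemma clampI1 : clampI 1 = one. Proof. by []. Qed.

Lemma clampI_le0 x : x <= 0 -> clampI x = zero.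
Proof.
move=> x0; rewrite -clampI0; apply: unitI_val_inj.
by rewrite [RHS]clampI_id// clampI_valE max_l// ge_min x0.
Qed.

Lemma clampI_ge1 x : 1 <= x -> clampI x = one.
Proof.
move=> x0; rewrite -clampI1; apply: unitI_val_inj.
by rewrite [RHS]clampI_id// clampI_valE min_r// max_r.
Qed.

Lemma unitI_val0 : unitI_val zero = 0.
Proof. by rewrite -clampI0 clampI_id. Qed.

Lemma unitI_val1 : unitI_val one = 1.
Proof. by rewrite -clampI1 clampI_id. Qed.

Lemma unitI_val_continuous : continuous unitI_val.
Proof. exact: initial_continuous. Qed.

Lemma continuous_minr (T : topologicalType) (f g : T -> R) :
  continuous f -> continuous g -> continuous (fun t => Num.min (f t) (g t)).
Proof. by move=> cf cg t; apply: continuous_min; [exact: cf|exact: cg]. Qed.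

Lemma continuous_maxr (T : topologicalType) (f g : T -> R) :
  continuous f -> continuous g -> continuous (fun t => Num.max (f t) (g t)).
Proof. by move=> cf cg t; apply: continuous_max; [exact: cf|exact: cg]. Qed.

Lemma continuous_addr (T : topologicalType) (f g : T -> R) :
  continuous f -> continuous g -> continuous (fun t => f t + g t).
Proof. by move=> cf cg t; apply: (@cvgD _ _ _ _ _ f g); [exact: cf|exact: cg]. Qed.

Lemma continuous_subr (T : topologicalType) (f g : T -> R) :
  continuous f -> continuous g -> continuous (fun t => f t - g t).
Proof. by move=> cf cg t; apply: (@cvgB _ _ _ _ _ f g); [exact: cf|exact: cg]. Qed.

Lemma continuous_mulr (T : topologicalType) (f g : T -> R) :
  continuous f -> continuous g -> continuous (fun t => f t * g t).
Proof. by move=> cf cg t; apply: (@cvgM _ _ _ _ f g); [exact: cf|exact: cg]. Qed.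

Lemma continuous_cstr (T : topologicalType) (a : R) : continuous (fun _ : T => a).
Proof. by move=> t; exact: cvg_cst. Qed.

Lemma clampI_continuous : continuous clampI.
Proof.
apply: (@continuous_comp_initial I _ R (set_val : I -> R) clampI).
apply: continuous_maxr; first by move=> ?; exact: cvg_cst.
by apply: continuous_minr => ?; [exact: cvg_id|exact: cvg_cst].
Qed.

Lemma comp_continuous (S T U : topologicalType) (f : S -> T) (g : T -> U) :
  continuous f -> continuous g -> continuous (fun s => g (f s)).
Proof. by move=> cf cg s; apply: continuous_comp; [exact: cf|exact: cg]. Qed.

Lemma clamp_continuous (T : topologicalType) (h : T -> R) :
  continuous h -> continuous (fun t => clampI (h t)).
Proof. by move=> ch; exact: comp_continuous ch clampI_continuous. Qed.

Lemma unitI_val_comp_continuous (T : topologicalType) (h : T -> I) :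
  continuous h -> continuous (fun t => unitI_val (h t)).
Proof. by move=> ch; exact: comp_continuous ch unitI_val_continuous. Qed.

Lemma pair_continuous (S T U : topologicalType) (f : S -> T) (g : S -> U) :
  continuous f -> continuous g -> continuous (fun s => (f s, g s)).
Proof. by move=> cf cg s; apply: cvg_pair; [exact: cf|exact: cg]. Qed.

Lemma fst_continuous (S T : topologicalType) : continuous (@fst S T).
Proof. by move=> p; exact: cvg_fst. Qed.

Lemma snd_continuous (S T : topologicalType) : continuous (@snd S T).
Proof. by move=> p; exact: cvg_snd. Qed.

Lemma affine_continuous (a b : R) : continuous (fun s : R => a * s + b).
Proof.
apply: continuous_addr; last exact: continuous_cstr.
by apply: continuous_mulr; [exact: continuous_cstr|move=> ?; exact: cvg_id].
Qed.

Lemma clamp_aff_continuous (T : topologicalType) (h : T -> R) (a b : R) :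
  continuous h -> continuous (fun s => clampI (a * h s - b)).
Proof.
move=> ch; apply: clamp_continuous; apply: continuous_subr.
  by apply: continuous_mulr => //; exact: continuous_cstr.
exact: continuous_cstr.
Qed.

Lemma clamp_opp_continuous (T : topologicalType) (h : T -> R) :
  continuous h -> continuous (fun s => clampI (1 - h s)).
Proof.
move=> ch; apply: clamp_continuous; apply: continuous_subr => //.
exact: continuous_cstr.
Qed.

Lemma continuous_if_le (T U : topologicalType) (h : T -> R) (c : R)
    (f g : T -> U) :
  continuous h -> continuous f -> continuous g ->
  (forall t, h t = c -> f t = g t) ->
  continuous (fun t => if h t <= c then f t else g t).
Proof.
move=> ch cf cg fg; apply/continuous_subspace_setT.
have -> : [set: T] = h @^-1` [set x | x <= c] `|` h @^-1` [set x | x >= c].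
  by apply/esym/seteqP; split => // t _ /=; case: (lerP (h t) c) => [|/ltW]; [left|right].
apply: withinU_continuous.
- by apply: closed_comp => [? _|]; [exact: ch|exact: closed_le].
- by apply: closed_comp => [? _|]; [exact: ch|exact: closed_ge].
- apply: (@subspace_eq_continuous _ _ _ f); last exact: continuous_subspaceT.
  by move=> t /set_mem /= ht; rewrite /from_subspace ht.
- apply: (@subspace_eq_continuous _ _ _ g); last exact: continuous_subspaceT.
  move=> t /set_mem /= ct; rewrite /from_subspace; case: ifP => // tc; apply/esym/fg.
  by apply/eqP; rewrite eq_le tc.
Qed.

End unitI.

Notation pathI R x y := {path (unitI R) from x to y}.

Section path_homotopy.
Context {R : realType} {T : topologicalType}.
Local Notation I := (unitI R).
Implicit Types x y z : T.

(* Homotopy relative to the endpoints, with image in [U]; the second coordinate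
   of [H] is the homotopy parameter. *)
Definition homotopic_in (U : set T) x y (f g : pathI R x y) : Prop :=
  exists H : I * I -> T,
    [/\ continuous H, range H `<=` U,
        forall s, H (s, zero) = f s, forall s, H (s, one) = g s
      & forall t, H (zero, t) = x /\ H (one, t) = y].

Definition homotopic x y (f g : pathI R x y) : Prop := homotopic_in setT f g.

Definition cst_path x : pathI R x x := (cst x : I -> T).

Section cat_path.
Context x y z (f : pathI R x y) (g : pathI R y z).

Definition cat_fun (s : I) : T :=
  if unitI_val s <= 2^-1 then f (clampI (2 * unitI_val s))
  else g (clampI (2 * unitI_val s - 1)).

Lemma cat_fun_continuous : continuous cat_fun.
Proof.
apply: continuous_if_le.
- exact: unitI_val_continuous.
- apply: comp_continuous; last exact: cts_fun.
  apply: clamp_continuous; apply: continuous_mulr; first exact: continuous_cstr.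
  exact: unitI_val_continuous.
- apply: comp_continuous; last exact: cts_fun.
  by apply: clamp_aff_continuous; exact: unitI_val_continuous.
- move=> s ->; rewrite clampI_ge1 ?clampI_le0 ?path_one ?path_zero//; lra.
Qed.

Lemma cat_fun0 : cat_fun zero = x.
Proof.
by rewrite /cat_fun unitI_val0 invr_ge0 ler0n mulr0 clampI_le0 ?path_zero.
Qed.

Lemma cat_fun1 : cat_fun one = z.
Proof.
rewrite /cat_fun unitI_val1 ifF; last by apply/negP; lra.
by rewrite clampI_ge1 ?path_one//; lra.
Qed.

Definition cat_path : pathI R x z := mk_path cat_fun_continuous cat_fun0 cat_fun1.

End cat_path.

Section rev_path.
Context x y (f : pathI R x y).

Definition rev_fun (s : I) : T := f (clampI (1 - unitI_val s)).

Lemma rev_fun_continuous : continuous rev_fun.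
Proof.
apply: comp_continuous; last exact: cts_fun.
by apply: clamp_opp_continuous; exact: unitI_val_continuous.
Qed.

Lemma rev_fun0 : rev_fun zero = y.
Proof. by rewrite /rev_fun unitI_val0 subr0 clampI_ge1 ?path_one. Qed.

Lemma rev_fun1 : rev_fun one = x.
Proof. by rewrite /rev_fun unitI_val1 subrr clampI_le0 ?path_zero. Qed.

Definition rev_path : pathI R y x := mk_path rev_fun_continuous rev_fun0 rev_fun1.

End rev_path.

Lemma cat_pathE x y z (f : pathI R x y) (g : pathI R y z) s :
  cat_path f g s = if unitI_val s <= 2^-1 then f (clampI (2 * unitI_val s))
                   else g (clampI (2 * unitI_val s - 1)).
Proof. by []. Qed.

Lemma rev_pathE x y (f : pathI R x y) s :
  rev_path f s = f (clampI (1 - unitI_val s)).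
Proof. by []. Qed.

Lemma homotopic_reparam x y (F : I -> T) (f g : pathI R x y) (u v : R -> R) :
  continuous F -> continuous u -> continuous v -> u 0 = v 0 -> u 1 = v 1 ->
  (forall s, f s = F (clampI (u (unitI_val s)))) ->
  (forall s, g s = F (clampI (v (unitI_val s)))) ->
  homotopic f g.
Proof.
move=> cF cu cv u0 u1 fE gE.
pose w (p : I * I) :=
  (1 - unitI_val p.2) * u (unitI_val p.1) + unitI_val p.2 * v (unitI_val p.1).
have c1 : continuous (fun p : I * I => unitI_val p.1).
  by apply: unitI_val_comp_continuous; exact: fst_continuous.
have c2 : continuous (fun p : I * I => unitI_val p.2).
  by apply: unitI_val_comp_continuous; exact: snd_continuous.
exists (fun p => F (clampI (w p))); split => //=.
- apply: comp_continuous cF; apply: clamp_continuous; apply: continuous_addr.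
  + apply: continuous_mulr; last exact: comp_continuous cu.
    by apply: continuous_subr => //; exact: continuous_cstr.
  + by apply: continuous_mulr => //; exact: comp_continuous cv.
- by move=> s; rewrite /w/= unitI_val0 subr0 mul1r mul0r addr0 -fE.
- by move=> s; rewrite /w/= unitI_val1 subrr mul0r mul1r add0r -gE.
- move=> t; rewrite /w/= !unitI_val0 !unitI_val1 -u0 -u1 -!mulrDl subrK !mul1r.
  by have := fE zero; have := fE one; rewrite unitI_val0 unitI_val1 path_zero path_one.
Qed.

Lemma homotopic_refl x y (f : pathI R x y) : homotopic f f.
Proof.
apply: (@homotopic_reparam _ _ f _ _ id id) => //.
- exact: cts_fun.
- by move=> ?; exact: cvg_id.
- by move=> ?; exact: cvg_id.
- by move=> s; rewrite /= unitI_valK.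
- by move=> s; rewrite /= unitI_valK.
Qed.

Lemma homotopic_sym x y (f g : pathI R x y) : homotopic f g -> homotopic g f.
Proof.
move=> [H [cH _ H0 H1 He]].
exists (fun p => H (p.1, clampI (1 - unitI_val p.2))); split => //=.
- apply: comp_continuous cH; apply: pair_continuous; first exact: fst_continuous.
  apply: clamp_opp_continuous; apply: unitI_val_comp_continuous.
  exact: snd_continuous.
- by move=> s; rewrite unitI_val0 subr0 clampI1.
- by move=> s; rewrite unitI_val1 subrr clampI0.
Qed.

Lemma homotopic_trans x y (f g h : pathI R x y) :
  homotopic f g -> homotopic g h -> homotopic f h.
Proof.
move=> [H [cH _ H0 H1 He]] [K [cK _ K0 K1 Ke]].
have c2 : continuous (fun p : I * I => unitI_val p.2).
  by apply: unitI_val_comp_continuous; exact: snd_continuous.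
exists (fun p => if unitI_val p.2 <= 2^-1
  then H (p.1, clampI (2 * unitI_val p.2 - 0))
  else K (p.1, clampI (2 * unitI_val p.2 - 1))).
split => //=.
- apply: continuous_if_le; first exact: c2.
  + apply: comp_continuous cH.
    by apply: pair_continuous; [exact: fst_continuous|exact: clamp_aff_continuous].
  + apply: comp_continuous cK.
    by apply: pair_continuous; [exact: fst_continuous|exact: clamp_aff_continuous].
  + move=> p ->; rewrite clampI_ge1 ?clampI_le0 ?H1 ?K0//; lra.
- move=> s; rewrite unitI_val0 ifT; last lra.
  by rewrite clampI_le0// mulr0 subr0.
- move=> s; rewrite unitI_val1 ifF; last by apply/negP; lra.
  by rewrite clampI_ge1//; lra.
- by move=> t; case: ifP => _; [exact: He|exact: Ke].
Qed.

Lemma homotopic_cat x y z (f f' : pathI R x y) (g g' : pathI R y z) :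
  homotopic f f' -> homotopic g g' ->
  homotopic (cat_path f g) (cat_path f' g').
Proof.
move=> [H [cH _ H0 H1 He]] [K [cK _ K0 K1 Ke]].
have c1 : continuous (fun p : I * I => unitI_val p.1).
  by apply: unitI_val_comp_continuous; exact: fst_continuous.
exists (fun p => if unitI_val p.1 <= 2^-1
  then H (clampI (2 * unitI_val p.1 - 0), p.2)
  else K (clampI (2 * unitI_val p.1 - 1), p.2)).
split => //=.
- apply: continuous_if_le; first exact: c1.
  + apply: comp_continuous cH.
    by apply: pair_continuous; [exact: clamp_aff_continuous|exact: snd_continuous].
  + apply: comp_continuous cK.
    by apply: pair_continuous; [exact: clamp_aff_continuous|exact: snd_continuous].
  + move=> p ->; rewrite clampI_ge1 ?clampI_le0 ?(He _).2 ?(Ke _).1//; lra.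
- by move=> s; rewrite cat_pathE subr0 H0 K0.
- by move=> s; rewrite cat_pathE subr0 H1 K1.
- move=> t; rewrite unitI_val0 unitI_val1 ifT; last lra.
  rewrite ifF; last by apply/negP; lra.
  rewrite clampI_le0; last lra.
  by rewrite clampI_ge1; [rewrite (He _).1 (Ke _).2|lra].
Qed.

Lemma homotopic_rev x y (f f' : pathI R x y) :
  homotopic f f' -> homotopic (rev_path f) (rev_path f').
Proof.
move=> [H [cH _ H0 H1 He]].
exists (fun p => H (clampI (1 - unitI_val p.1), p.2)); split => //=.
- apply: comp_continuous cH; apply: pair_continuous; last exact: snd_continuous.
  apply: clamp_opp_continuous; apply: unitI_val_comp_continuous.
  exact: fst_continuous.
- by move=> s; rewrite rev_pathE H0.
- by move=> s; rewrite rev_pathE H1.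
- move=> t; rewrite unitI_val0 unitI_val1 subr0 subrr clampI0 clampI1.
  by case: (He t).
Qed.

Lemma homotopic_cat1p x y (f : pathI R x y) : homotopic (cat_path (cst_path x) f) f.
Proof.
apply: (@homotopic_reparam _ _ f _ _ (fun s => Num.max 0 (2 * s + -1)) id) => //.
- exact: cts_fun.
- apply: continuous_maxr; last exact: affine_continuous.
  by move=> ?; exact: cvg_cst.
- by move=> ?; exact: cvg_id.
- by rewrite max_l//; lra.
- by rewrite max_r; lra.
- move=> s; rewrite cat_pathE; case: lerP => s2.
    by rewrite max_l; [rewrite clampI0 path_zero|lra].
  by rewrite max_r//; lra.
- by move=> s; rewrite /= unitI_valK.
Qed.

Lemma homotopic_catp1 x y (f : pathI R x y) : homotopic (cat_path f (cst_path y)) f.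
Proof.
apply: (@homotopic_reparam _ _ f _ _ (fun s => Num.min 1 (2 * s + 0)) id) => //.
- exact: cts_fun.
- apply: continuous_minr; last exact: affine_continuous.
  by move=> ?; exact: cvg_cst.
- by move=> ?; exact: cvg_id.
- by rewrite min_r//; lra.
- by rewrite min_l; lra.
- move=> s; rewrite cat_pathE; case: lerP => s2.
    by rewrite min_r ?addr0//; lra.
  by rewrite min_l; [rewrite clampI1 path_one|lra].
- by move=> s; rewrite /= unitI_valK.
Qed.

Lemma homotopic_catVp x y (f : pathI R x y) :
  homotopic (cat_path (rev_path f) f) (cst_path y).
Proof.
apply: (@homotopic_reparam _ _ f _ _
  (fun s => Num.max (- 2 * s + 1) (2 * s + -1)) (cst 1)) => //.
- exact: cts_fun.
- by apply: continuous_maxr; exact: affine_continuous.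
- by move=> ?; exact: cvg_cst.
- by rewrite max_l /=; lra.
- by rewrite max_r /=; lra.
- move=> s; have s0 := unitI_val_ge0 s; rewrite cat_pathE; case: lerP => s2.
    rewrite rev_pathE max_l ?clampI_id; [|lra..].
    by congr (f (clampI _)); lra.
  by rewrite max_r//; lra.
- by move=> s; rewrite /= clampI1 path_one.
Qed.

Lemma homotopic_catpV x y (f : pathI R x y) :
  homotopic (cat_path f (rev_path f)) (cst_path x).
Proof.
apply: (@homotopic_reparam _ _ f _ _
  (fun s => Num.min (2 * s + 0) (- 2 * s + 2)) (cst 0)) => //.
- exact: cts_fun.
- by apply: continuous_minr; exact: affine_continuous.
- by move=> ?; exact: cvg_cst.
- by rewrite min_l /=; lra.
- by rewrite min_r /=; lra.
- move=> s; have s1 := unitI_val_le1 s; rewrite cat_pathE; case: lerP => s2.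
    by rewrite min_l ?addr0//; lra.
  rewrite rev_pathE min_r ?clampI_id; [|lra..].
  by congr (f (clampI _)); lra.
- by move=> s; rewrite /= clampI0 path_zero.
Qed.

Lemma homotopic_catA w x y z (f : pathI R w x) (g : pathI R x y) (h : pathI R y z) :
  homotopic (cat_path f (cat_path g h)) (cat_path (cat_path f g) h).
Proof.
apply: (@homotopic_reparam _ _ (cat_path (cat_path f g) h) _ _
  (fun s => Num.max (2^-1 * s + 0) (Num.max (1 * s + - 4^-1) (2 * s + -1))) id)
  => //.
- exact: cts_fun.
- apply: continuous_maxr; first exact: affine_continuous.
  by apply: continuous_maxr; exact: affine_continuous.
- by move=> ?; exact: cvg_id.
- by rewrite max_l; [lra|rewrite ge_max; apply/andP; split; lra].
- rewrite max_r; last by rewrite le_max; apply/orP; right; lra.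
  by rewrite max_r; lra.
- move=> s; have s0 := unitI_val_ge0 s; have s1 := unitI_val_le1 s.
  rewrite [LHS]cat_pathE; case: (lerP (unitI_val s)) => s2.
    rewrite max_l ?ge_max; last by apply/andP; split; lra.
    rewrite cat_pathE clampI_id; [|lra..].
    rewrite ifT; last lra.
    rewrite cat_pathE clampI_id; [|lra..].
    rewrite ifT; last lra.
    by congr (f (clampI _)); lra.
  rewrite [LHS]cat_pathE clampI_id; [|lra..].
  case: (lerP _ 2^-1) => s3.
    rewrite max_r; last by rewrite le_max; apply/orP; left; lra.
    rewrite max_l; last lra.
    rewrite cat_pathE clampI_id; [|lra..].
    rewrite ifT; last lra.
    rewrite cat_pathE clampI_id; [|lra..].
    rewrite ifF; last by apply/negP; lra.
    by congr (g (clampI _)); lra.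
  rewrite max_r; last by rewrite le_max; apply/orP; right; lra.
  rewrite max_r; last lra.
  rewrite cat_pathE clampI_id; [|lra..].
  rewrite ifF; last by apply/negP; lra.
  by congr (h (clampI _)); lra.
- by move=> s; rewrite /= unitI_valK.
Qed.

End path_homotopy.

Section fundamental_group.
Context {R : realType} {Y : topologicalType} (y : Y).
Implicit Types f g h : pathI R y y.

Definition loop_rel f g : bool := `[< homotopic f g >].

Lemma loop_rel_refl : reflexive loop_rel.
Proof. by move=> f; apply/asboolP; exact: homotopic_refl. Qed.

Lemma loop_rel_sym : symmetric loop_rel.
Proof. by move=> f g; apply/idP/idP => /asboolP/homotopic_sym/asboolP. Qed.

Lemma loop_rel_trans : transitive loop_rel.
Proof.
move=> g f h /asboolP fg /asboolP gh; apply/asboolP.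
exact: homotopic_trans fg gh.
Qed.

Definition loop_equiv := EquivRel _ loop_rel_refl loop_rel_sym loop_rel_trans.

(* Loops carry the compact-open topology, through the library instance for paths. *)
Definition pi1qtop : Type := {eq_quot loop_equiv}.

HB.instance Definition _ := Quotient.on pi1qtop.
HB.instance Definition _ :=
  Topological.copy pi1qtop (quotient_topology {eq_quot loop_equiv}).

Lemma pi1_eqP f g : \pi_pi1qtop f = \pi_pi1qtop g <-> homotopic f g.
Proof.
by split => [/eqmodP/asboolP//|fg]; apply/eqmodP/asboolP.
Qed.

Lemma pi1_ind (P : pi1qtop -> Prop) :
  (forall f, P (\pi_pi1qtop f)) -> forall a, P a.
Proof. by move=> Pf a; rewrite -[a]reprK. Qed.

Lemma homotopic_repr f : homotopic (repr (\pi_pi1qtop f)) f.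
Proof. by apply/pi1_eqP; rewrite reprK. Qed.

Definition pi1_one : pi1qtop := \pi_pi1qtop (cst_path y).
Definition pi1_mul (a b : pi1qtop) : pi1qtop :=
  \pi_pi1qtop (cat_path (repr a) (repr b)).
Definition pi1_inv (a : pi1qtop) : pi1qtop := \pi_pi1qtop (rev_path (repr a)).

Lemma pi1_mulE f g :
  pi1_mul (\pi_pi1qtop f) (\pi_pi1qtop g) = \pi_pi1qtop (cat_path f g).
Proof. by apply/pi1_eqP; apply: homotopic_cat; exact: homotopic_repr. Qed.

Lemma pi1_invE f : pi1_inv (\pi_pi1qtop f) = \pi_pi1qtop (rev_path f).
Proof. by apply/pi1_eqP; apply: homotopic_rev; exact: homotopic_repr. Qed.

Lemma pi1_mulA : associative pi1_mul.
Proof.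
elim/pi1_ind => f; elim/pi1_ind => g; elim/pi1_ind => h.
by rewrite !pi1_mulE; apply/pi1_eqP; exact: homotopic_catA.
Qed.

Lemma pi1_mul1g : left_id pi1_one pi1_mul.
Proof.
by elim/pi1_ind => f; rewrite pi1_mulE; apply/pi1_eqP; exact: homotopic_cat1p.
Qed.

Lemma pi1_mulg1 : right_id pi1_one pi1_mul.
Proof.
by elim/pi1_ind => f; rewrite pi1_mulE; apply/pi1_eqP; exact: homotopic_catp1.
Qed.

Lemma pi1_mulVg : left_inverse pi1_one pi1_inv pi1_mul.
Proof.
elim/pi1_ind => f; rewrite pi1_invE pi1_mulE; apply/pi1_eqP.
exact: homotopic_catVp.
Qed.

Lemma pi1_mulgV : right_inverse pi1_one pi1_inv pi1_mul.
Proof.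
elim/pi1_ind => f; rewrite pi1_invE pi1_mulE; apply/pi1_eqP.
exact: homotopic_catpV.
Qed.

HB.instance Definition _ := isGroup.Build pi1qtop
  pi1_mulA pi1_mul1g pi1_mulg1 pi1_mulVg pi1_mulgV.

Lemma pi1_mulgE f g :
  (\pi_pi1qtop f * \pi_pi1qtop g)%g = \pi_pi1qtop (cat_path f g).
Proof. exact: pi1_mulE. Qed.

End fundamental_group.

Arguments pi1qtop R {Y} y.

Section induced_map.
Context {R : realType} {Y Z : topologicalType} (f : continuousType Y Z) (y : Y).

Definition loop_map (g : pathI R y y) : pathI R (f y) (f y) :=
  (f \o g : unitI R -> Z).

(* The value does not depend on the representative, see [pi1_mapE]. *)
Definition pi1_map (a : pi1qtop R y) : pi1qtop R (f y) :=
  \pi_(pi1qtop R (f y)) (loop_map (repr a)).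

Lemma homotopic_loop_map g h :
  homotopic g h -> homotopic (loop_map g) (loop_map h).
Proof.
move=> [H [cH _ H0 H1 He]]; exists (f \o H); split => //=.
- by apply: comp_continuous cH _; exact: cts_fun.
- by move=> s; rewrite H0.
- by move=> s; rewrite H1.
- by move=> t; have [-> ->] := He t.
Qed.

Lemma pi1_mapE g : pi1_map (\pi_(pi1qtop R y) g) = \pi_(pi1qtop R (f y)) (loop_map g).
Proof.
apply/pi1_eqP.
by apply: homotopic_loop_map; exact: homotopic_repr.
Qed.

Lemma pi1_mapM : {morph pi1_map : a b / (a * b)%g >-> (a * b)%g}.
Proof.
elim/(@pi1_ind R Y y) => g; elim/(@pi1_ind R Y y) => h.
rewrite pi1_mulgE !pi1_mapE pi1_mulgE; congr (\pi_(pi1qtop R (f y)) _).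
by apply/path_eqP => s; rewrite /= /loop_map /= !cat_pathE; case: ifP.
Qed.

Lemma loop_map_continuous : continuous loop_map.
Proof.
pose co (Z' : topologicalType) (z : Z') : pathI R z z -> {compact-open, unitI R -> Z'} := id.
apply: (@continuous_comp_initial (pathI R (f y) (f y)) _ _ (co _ _) loop_map) => g.
refine (proj2 (@compact_open_cvgP _ _ ((co _ _ \o loop_map) @ g) _ _) _).
  by apply: fmap_filter; exact: (@nbhs_filter (pathI R y y)).
move=> K O cK oO gKO.
have oW : open (co Y y @^-1` [set h | h @` K `<=` f @^-1` O]).
  apply: open_comp => [h _|]; first exact: initial_continuous.
  apply: compact_open_open => //; apply: open_comp => // t _; exact: cts_fun.
have : nbhs g (co Y y @^-1` [set h | h @` K `<=` f @^-1` O]).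
  apply: open_nbhs_nbhs; split => // _ [t Kt <-]; apply: gKO.
  by exists t.
by apply: filterS => h hKO _ [t Kt <-]; apply: hKO; exists t.
Qed.

Lemma pi1_map_continuous : continuous pi1_map.
Proof.
apply/quotient_continuous => g.
rewrite (_ : pi1_map \o _ = \pi_(pi1qtop R (f y)) \o loop_map); last first.
  by apply/funext => h; exact: pi1_mapE.
by apply: continuous_comp; [exact: loop_map_continuous|exact: pi_continuous].
Qed.

End induced_map.

Arguments pi1_map {R Y Z} f y _.

Section collapse.
Context {X : topologicalType} {n : nat} (A : 'I_n -> set X).

(* An empty [A i] contributes nothing to the relation, hence no extra point. *)
Definition collapse_rel (x y : X) : bool :=
  `[< x = y \/ exists i, A i x /\ A i y >].

Lemma collapse_rel_refl : reflexive collapse_rel.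
Proof. by move=> x; apply/asboolP; left. Qed.

Lemma collapse_rel_sym : symmetric collapse_rel.
Proof.
by move=> x y; apply/asbool_equiv_eq; split=> -[->|[i [? ?]]];
  [left|right; exists i|left|right; exists i].
Qed.

Context (dA : trivIset [set: 'I_n] A).

Lemma collapse_rel_trans : transitive collapse_rel.
Proof.
move=> y x z /asboolP[->//|[i [Aix Aiy]]] /asboolP[<-|[j [Ajy Ajz]]];
  apply/asboolP; right; first by exists i.
have ij : i = j by apply: dA => //; exists y.
by exists i; split=> //; rewrite ij.
Qed.

Definition collapse_equiv :=
  EquivRel _ collapse_rel_refl collapse_rel_sym collapse_rel_trans.

Definition collapse : Type := {eq_quot collapse_equiv}.

HB.instance Definition _ := Quotient.on collapse.
HB.instance Definition _ :=
  Topological.copy collapse (quotient_topology {eq_quot collapse_equiv}).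

Definition collapse_map : X -> collapse := \pi_collapse.

Lemma collapse_map_continuous : continuous collapse_map.
Proof. exact: pi_continuous. Qed.

HB.instance Definition _ :=
  isContinuous.Build X collapse collapse_map collapse_map_continuous.

End collapse.

Section local_connectedness.
Context (R : realType) (Y : topologicalType).

Definition path_connected (V : set Y) : Prop :=
  forall u v, V u -> V v -> exists f : pathI R u v, range f `<=` V.

Definition locally_path_connected : Prop :=
  forall (y : Y) (U : set Y), open_nbhs y U ->
    exists V, [/\ open_nbhs y V, V `<=` U & path_connected V].

Definition locally_simply_connected : Prop :=
  forall (y : Y) (U : set Y), open_nbhs y U ->
    exists V, [/\ open_nbhs y V, V `<=` U
      & forall (z : Y) (f : pathI R z z), range f `<=` V ->
          homotopic_in U f (cst_path z)].

Definition locally_1connected : Prop :=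
  locally_path_connected /\ locally_simply_connected.

End local_connectedness.

(* Main.v *)
(* A path in X/(A_1,...,A_n) is cut into finitely many pieces, each of which
   either avoids the points [A_i], and then lifts to X, or stays close to a single
   [A_i], but may meet the point [A_i] infinitely often. In the second case let U
   be the open set of times at which the point is not met; there the piece lifts to
   a path w in X, whose distance to [A_i] tends to 0 at the boundary of U. Tile U by
   maximal dyadic intervals on which w moves little compared with its distance to
   [A_i]. Since [A_i] is compact and everything is locally 1-connected, w can be
   pushed into [A_i] on each tile, compatibly at the common endpoints, inside a
   neighborhood of [A_i] that shrinks with the distance from w to [A_i]; hence the
   push extends continuously by the constant map outside U. The piece is thus
   homotopic to the image of: a short path into [A_i], a path in [A_i], and a short
   path back. So every loop is homotopic to the image of a loop in X. *)

Require Import Defs.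
From mathcomp Require Import all_boot all_order all_algebra generic_quotient.
From mathcomp Require Import ring lra zify.
From mathcomp Require Import all_classical all_reals all_analysis homotopy.
Import Order.TTheory GRing.Theory Num.Theory.
Import numFieldTopology.Exports numFieldNormedType.Exports.

Set Implicit Arguments.
Unset Strict Implicit.
Unset Printing Implicit Defensive.

Local Open Scope classical_set_scope.
Local Open Scope ring_scope.
Local Open Scope quotient_scope.

(** * Retraction of the line onto the unit interval *)

Section clamp.
Context {R : realType}.
Implicit Types s t : R.

Definition clamp s : R := unitI_val (clampI s).

Lemma clamp_ge0 s : 0 <= clamp s. Proof. exact: unitI_val_ge0. Qed.

Lemma clamp_le1 s : clamp s <= 1. Proof. exact: unitI_val_le1. Qed.

Lemma clamp_id s : 0 <= s -> s <= 1 -> clamp s = s.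
Proof. exact: clampI_id. Qed.

Lemma clamp_le0 s : s <= 0 -> clamp s = 0.
Proof. by move=> s0; rewrite /clamp clampI_le0// unitI_val0. Qed.

Lemma clamp_ge1 s : 1 <= s -> clamp s = 1.
Proof. by move=> s1; rewrite /clamp clampI_ge1// unitI_val1. Qed.

Lemma clamp0 : clamp 0 = 0. Proof. exact: clamp_le0. Qed.

Lemma clamp1 : clamp 1 = 1. Proof. exact: clamp_ge1. Qed.

Lemma continuous_clamp (T : topologicalType) (h : T -> R) :
  continuous h -> continuous (fun x => clamp (h x)).
Proof. by move=> ch; apply: unitI_val_comp_continuous; exact: clamp_continuous. Qed.

End clamp.

(** * Paths on the line and their concatenation *)

Section paths.
Context {R : realType} {T : topologicalType}.
Implicit Types (x y : T) (V : set T) (f : R -> T).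

(* Paths are parametrized by the whole line and constant outside [0, 1]. *)
Definition path_in V x y f :=
  [/\ continuous f, forall s : R, s <= 0 -> f s = x, forall s : R, 1 <= s -> f s = y
    & forall s, V (f s)].

Lemma path_in_pathI V x y (g : pathI R x y) :
  range g `<=` V -> path_in V x y (fun s => g (clampI s)).
Proof.
move=> gV; split.
- by apply: comp_continuous; [exact: clampI_continuous|exact: cts_fun].
- by move=> s s0; rewrite clampI_le0// path_zero.
- by move=> s s1; rewrite clampI_ge1// path_one.
- by move=> s; apply: gV; exists (clampI s).
Qed.

Lemma path_in_sub V V' x y f :
  V `<=` V' -> path_in V x y f -> path_in V' x y f.
Proof. by move=> VV' [cf f0 f1 fV]; split => // s; apply: VV'. Qed.

Lemma path_in_cst V x : V x -> path_in V x x (fun=> x).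
Proof. by move=> Vx; split => // ?; exact: cvg_cst. Qed.

Lemma path_in_rev V x y f :
  path_in V x y f -> path_in V y x (fun s => f (1 - s)).
Proof.
move=> [cf f0 f1 fV]; split => //.
- apply: comp_continuous cf; apply: continuous_subr; first exact: continuous_cstr.
  by move=> ?; exact: cvg_id.
- by move=> s s0; apply: f1; lra.
- by move=> s s0; apply: f0; lra.
Qed.

Lemma path_in_cat V x y z f g :
  path_in V x y f -> path_in V y z g ->
  path_in V x z (fun s => if s <= 2^-1 then f (2 * s) else g (2 * s - 1)).
Proof.
move=> [cf f0 f1 fV] [cg g0 g1 gV]; split.
- apply: continuous_if_le.
  + by move=> ?; exact: cvg_id.
  + apply: comp_continuous cf; apply: continuous_mulr; first exact: continuous_cstr.
    by move=> ?; exact: cvg_id.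
  + apply: comp_continuous cg; exact: affine_continuous.
  + by move=> s ->; rewrite f1 ?g0//; lra.
- by move=> s s0; rewrite ifT; [apply: f0; lra|lra].
- by move=> s s0; rewrite ifF; [apply: g1; lra|apply/negP; lra].
- by move=> s; case: ifP.
Qed.

End paths.

(** * Choices with a modulus *)

Section modulus.
Context {R : realType}.

(** One choice serves all [e]: [c x] is taken within [d x] of the infimum of the precisions
    attainable at [x], and this slack vanishes as [d x] tends to 0. *)
Lemma choice_modulus (T G : Type) (g0 : G) (d : T -> R) (S : T -> G -> R -> Prop) :
  (forall x g e e', e <= e' -> S x g e -> S x g e') ->
  (forall e, 0 < e -> exists2 r, 0 < r &
     forall x, 0 < d x -> d x < r -> exists g, S x g e) ->
  exists c : T -> G, forall e, 0 < e -> exists2 r, 0 < r &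
     forall x, 0 < d x -> d x < r -> S x (c x) e.
Proof.
move=> Sle Sex.
pose E x := [set e | 0 < e /\ exists g, S x g e].
have lbE x : lbound (E x) 0 by move=> e [/ltW].
have /choice[c cP] (x : T) : exists g, 0 < d x -> E x !=set0 -> S x g (inf (E x) + d x).
  have [dx|] := ltP 0 (d x); last by exists g0.
  have [E0|] := pselect (E x !=set0); last by exists g0.
  have [|e [e0 [g Sg]] ex] := @inf_adherent _ (E x) _ dx.
    by split => //; exists 0.
  by exists g => _ _; apply: Sle Sg; exact: ltW.
exists c => e e0; have e20 : 0 < e / 2 by lra.
have [r r0 rP] := Sex _ e20.
(* One half of [e] bounds the infimum, the other half the slack [d x]. *)
exists (Num.min r (e / 2)); first by rewrite lt_min r0.
move=> x dx; rewrite lt_min => /andP[dxr dxe].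
have [g Sg] := rP _ dx dxr.
have Ee : E x (e / 2) by split => //; exists g.
apply: Sle (cP _ dx _); last by exists (e / 2).
have : inf (E x) <= e / 2 by apply: ge_inf => //; exists 0.
lra.
Qed.

End modulus.

(** * Uniformity over compact sets *)

Section metric.
Context {R : realType} {X : metricType R}.
Implicit Types (A : set X) (S : set X -> set X -> Prop).

Lemma in_ball (x y : X) (r : R) : ball x r y <-> mdist x y < r.
Proof. by rewrite ballEmdist. Qed.

(** A radius found at [a] also serves all nearby centers, the gap between [e / 2] and [e] absorbing
    the change of center; compactness then yields one radius. *)
Lemma compact_uniform A S (e : R) : compact A -> 0 < e ->
  (forall V V' U U', V' `<=` V -> U `<=` U' -> S V U -> S V' U') ->
  (forall a, A a -> exists2 r, 0 < r & S (ball a r) (ball a (e / 2))) ->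
  exists2 r, 0 < r & forall a, A a -> S (ball a r) (ball a e).
Proof.
move=> /compact_near_coveringP cA e0 Smono Sloc.
have := cA R (0^'+) (fun r a => S (ball a r) (ball a e)) _.
case.
- move=> a Aa; have [r r0 Sr] := Sloc _ Aa.
  pose q := Num.min (r / 2) (e / 2).
  have q0 : 0 < q by rewrite lt_min; apply/andP; split; lra.
  exists (ball a q, [set t : R | t < q]) => /=.
    split; first exact: nbhsx_ballx.
    by apply: nbhs_right_lt.
  move=> [b t] /= [/in_ball ab tq].
  move: ab tq; rewrite /q !lt_min => /andP[ab1 ab2] /andP[t1 t2].
  apply: Smono Sr => z /in_ball zb; apply/in_ball.
    by have := metric_triangle a b z; lra.
  by have := metric_triangle b a z; rewrite (metric_sym b a); lra.
- move=> r /= r0 rP; exists (r / 2); first lra.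
  by apply: rP => /=; [rewrite sub0r normrN gtr0_norm; lra|lra].
Qed.

End metric.

Ltac minmax_free a :=
  lazymatch a with
  | context [Num.min _ _] => fail
  | context [Num.max _ _] => fail
  | _ => idtac
  end.

(** Innermost occurrences are split first, so that each comparison added to the context is linear
    for [lra]. *)
Ltac minmax := repeat match goal with
  | |- context [Num.min ?a ?b] =>
      minmax_free a; minmax_free b; case: (lerP a b) => ?
  | |- context [Num.max ?a ?b] =>
      minmax_free a; minmax_free b; case: (lerP a b) => ?
  end; lra.

(** * Explicit parametrization of the sides of a square *)

Section left_side.
Context {R : realType}.
Implicit Types t : R.

(* On [0, 1/2] the point [(left1 t, left2 t)] runs along the left, top and right
   sides of the unit square, on [1/2, 1] along the bottom from [(1, 0)] back to
   [(3/4, 0)]. *)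
Definition left1 t := Num.min (Num.max 0 (8 * t - 1)) (Num.min 1 (5 / 4 - t / 2)).
Definition left2 t := Num.max 0 (Num.min (8 * t) (Num.min 1 (4 - 8 * t))).

(** Loop parameter on the right side in [square_filling]: it rests at 1/4, where [f] ends, then runs
    to 1/2 along [dy]. *)
Definition right1 t := 4^-1 + Num.max 0 (2 * t - 1) / 4.

Lemma right1_continuous : continuous right1.
Proof.
apply: continuous_addr; first exact: continuous_cstr.
apply: continuous_mulr; last exact: continuous_cstr.
by apply: continuous_maxr; [exact: continuous_cstr|exact: affine_continuous].
Qed.

Lemma right1_le t : t <= 2^-1 -> right1 t = 4^-1.
Proof. by move=> ?; rewrite /right1; minmax. Qed.

Lemma right1_ge t : 2^-1 <= t -> right1 t = t / 2.
Proof. by move=> ?; rewrite /right1; minmax. Qed.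

Lemma left1_continuous : continuous left1.
Proof.
have cid : continuous (fun t : R => t) by move=> ?; exact: cvg_id.
have cst (a : R) : continuous (fun _ : R => a) by exact: continuous_cstr.
apply: continuous_minr; first by apply: continuous_maxr => //; exact: affine_continuous.
by apply: continuous_minr => //; apply: continuous_subr => //; exact: continuous_mulr.
Qed.

Lemma left2_continuous : continuous left2.
Proof.
have cid : continuous (fun t : R => t) by move=> ?; exact: cvg_id.
have cst (a : R) : continuous (fun _ : R => a) by exact: continuous_cstr.
apply: continuous_maxr => //; apply: continuous_minr; first exact: continuous_mulr.
by apply: continuous_minr => //; apply: continuous_subr => //; exact: continuous_mulr.
Qed.

Lemma left1_le0 t : t <= 8^-1 -> left1 t <= 0.
Proof. by move=> ?; rewrite /left1; minmax. Qed.

Lemma left2_ge1 t : 8^-1 <= t -> t <= 3 / 8 -> 1 <= left2 t.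
Proof. by move=> ? ?; rewrite /left2; minmax. Qed.

Lemma left1_ge1 t : 3 / 8 <= t -> t <= 2^-1 -> 1 <= left1 t.
Proof. by move=> ? ?; rewrite /left1; minmax. Qed.

Lemma left1_id t : 2^-1 <= t -> t <= 1 -> left1 t = 5 / 4 - t / 2.
Proof. by move=> ? ?; rewrite /left1; minmax. Qed.

Lemma left2_eq0 t : t <= 0 \/ 2^-1 <= t -> left2 t = 0.
Proof. by move=> [?|?]; rewrite /left2; minmax. Qed.

Lemma left1_0 : left1 0 = 0.
Proof. by rewrite /left1; minmax. Qed.

End left_side.

(** * Filling squares by contracting their boundary *)

Section filling.
Context {R : realType} {T : topologicalType}.
Implicit Types (x y : T) (V U : set T).

Lemma path_in_clamp V x y (f : R -> T) s :
  path_in V x y f -> f (clamp s) = f s.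
Proof.
move=> [_ f0 f1 _]; have [s0|s0] := lerP s 0.
  by rewrite clamp_le0// !f0.
have [s1|s1] := lerP 1 s; first by rewrite clamp_ge1// !f1.
by rewrite clamp_id//; lra.
Qed.

Definition loops_contract_in V U := forall z (g : pathI R z z),
  range g `<=` V -> homotopic_in U g (cst_path z).

(** Clamping both coordinates extends the contraction from the unit square to the plane; all sides
    but the bottom go to the base point. *)
Lemma contract_loop V U x (l : R -> T) :
  loops_contract_in V U -> path_in V x x l ->
  exists H : R * R -> T, [/\ continuous H, forall p, U (H p),
    forall s, H (s, 0) = l s, forall s t : R, 1 <= t -> H (s, t) = x
    & forall s t : R, s <= 0 \/ 1 <= s -> H (s, t) = x].
Proof.
move=> VU /[dup] lP [cl l0 l1 lV].
have cg : continuous (fun s : unitI R => l (unitI_val s)).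
  by apply: comp_continuous cl; exact: unitI_val_continuous.
have g0 : l (unitI_val (zero : unitI R)) = x by rewrite unitI_val0 l0.
have g1 : l (unitI_val (one : unitI R)) = x by rewrite unitI_val1 l1.
have [|H [cH HU H0 H1 He]] := VU x (mk_path cg g0 g1).
  by move=> _ [s _ <-]; exact: lV.
exists (fun p => H (clampI p.1, clampI p.2)); split.
- apply: comp_continuous cH; apply: pair_continuous; apply: clamp_continuous.
    exact: fst_continuous.
  exact: snd_continuous.
- by move=> p; apply: HU; exists (clampI p.1, clampI p.2).
- move=> s; rewrite [clampI (s, 0).2]clampI_le0 ?lexx// H0.
  by rewrite /mk_path /=; exact: path_in_clamp lP.
- by move=> s t t1; rewrite /= (clampI_ge1 t1) H1.
- by move=> s t [s0|s1] /=; rewrite ?(clampI_le0 s0) ?(clampI_ge1 s1); have [] := He (clampI t).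
Qed.

(* The boundary of the square, traversed from the corner [x], is a loop. Its
   contraction fills the square once that corner is blown up to the lower half
   of the left side, which is sent to the three other sides of the domain of
   the contraction; hence the reparametrized sides [2 * t - 1]. *)
Lemma square_filling V U x y b b' f dx dy c :
  loops_contract_in V U ->
  path_in V x y f -> path_in V x b dx -> path_in V y b' dy -> path_in V b b' c ->
  exists K : R * R -> T, [/\ continuous K, forall p, U (K p),
    forall s, K (s, 0) = f s, forall s, K (s, 1) = c s
    & forall t, K (0, t) = dx (2 * t - 1) /\ K (1, t) = dy (2 * t - 1)].
Proof.
move=> VU fP dxP dyP cP.
have lP := path_in_cat (path_in_cat fP dyP) (path_in_cat (path_in_rev cP) (path_in_rev dxP)).
have [H [cH HU H0 H1 He]] := contract_loop VU lP.
(* The horizontal line at height [t] goes to the segment from [(left1 t, left2 t)] to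
   [(right1 t, 0)]. *)
pose P1 (s t : R) : R := (1 - s) * left1 t + s * right1 t.
pose P2 (s t : R) : R := (1 - s) * left2 t.
have cid : continuous (fun t : R => t) by move=> ?; exact: cvg_id.
have cst (a : R) : continuous (fun _ : R => a) by exact: continuous_cstr.
have c1 : continuous (fun p : R * R => clamp p.1).
  by apply: continuous_clamp; exact: fst_continuous.
have c2 : continuous (fun p : R * R => clamp p.2).
  by apply: continuous_clamp; exact: snd_continuous.
have cst2 (a : R) : continuous (fun _ : R * R => a) by exact: continuous_cstr.
exists (fun p => H (P1 (clamp p.1) (clamp p.2), P2 (clamp p.1) (clamp p.2))).
split => //=.
- apply: comp_continuous cH; apply: pair_continuous.
    apply: continuous_addr; apply: continuous_mulr => //.
    + exact: continuous_subr.
    + exact: comp_continuous left1_continuous.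
    + exact: comp_continuous right1_continuous.
  apply: continuous_mulr; first exact: continuous_subr.
  exact: comp_continuous left2_continuous.
- move=> s; rewrite clamp0 /P2 /P1.
  rewrite left1_0 right1_le ?left2_eq0; [|by left|lra].
  rewrite mulr0 H0 -(path_in_clamp s fP).
  have := clamp_ge0 s; have := clamp_le1 s => s1 s0.
  rewrite ifT; last lra.
  rewrite ifT; last lra.
  by congr f; lra.
- move=> s; rewrite clamp1 /P2 /P1.
  rewrite left1_id ?right1_ge ?left2_eq0; [|by right; lra|lra..].
  rewrite mulr0 H0 -(path_in_clamp s cP).
  have := clamp_ge0 s; have := clamp_le1 s => s1 s0.
  (* At the corner the loop parameter is the junction 1/2, which the concatenation assigns to the
     end of [dy] rather than to [c]. *)
  have [s1'|s1'] := eqVneq (clamp s) 1.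
    rewrite s1'; rewrite ifT; last lra.
    rewrite ifF; last by apply/negP; lra.
    case: cP => _ _ c1' _; case: dyP => _ _ d1 _.
    by rewrite c1'// d1//; lra.
  have {}s1' : clamp s < 1 by rewrite lt_neqAle s1'.
  rewrite ifF; last by apply/negP; lra.
  rewrite ifT; last lra.
  by congr c; lra.
- move=> t; rewrite clamp0 clamp1 /P2 /P1 !subr0 !subrr !mul0r !mul1r addr0 add0r.
  have := clamp_ge0 t; have := clamp_le1 t => t1 t0; split.
    have -> : dx (2 * t - 1) = dx (2 * clamp t - 1).
      case: dxP => _ d0 d1 _; have [u0|u0] := lerP t 0.
        by rewrite clamp_le0// !d0//; lra.
      have [u1|u1] := lerP 1 t; first by rewrite clamp_ge1// !d1//; lra.
      by rewrite clamp_id//; lra.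
    move: (clamp t) t0 t1 => {}t t0 t1; case: (dxP) => _ d0 d1 _.
    have [u1|u1] := lerP t (8^-1).
      rewrite He ?d0; [by []|lra|left].
      exact: left1_le0.
    have [u2|u2] := lerP t (3 / 8).
      rewrite H1 ?d0; [by []|lra|].
      by apply: left2_ge1 => //; lra.
    have [u3|u3] := lerP t (2^-1).
      rewrite He ?d0; [by []|lra|right].
      by apply: left1_ge1 => //; lra.
    rewrite left2_eq0; last by right; lra.
    rewrite left1_id//; last lra.
    rewrite H0 ifF; last by apply/negP; lra.
    have [v|v] := lerP (2 * (5 / 4 - t / 2) - 1) (2^-1).
      have -> : t = 1 by lra.
      rewrite d1; last lra.
      by case: cP => _ c0' _ _; rewrite c0'//; lra.
    by congr dx; lra.
  have -> : dy (2 * t - 1) = dy (2 * clamp t - 1).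
    case: dyP => _ d0 d1 _; have [u0|u0] := lerP t 0.
      by rewrite clamp_le0// !d0//; lra.
    have [u1|u1] := lerP 1 t; first by rewrite clamp_ge1// !d1//; lra.
    by rewrite clamp_id//; lra.
  move: (clamp t) t0 t1 => {}t t0 t1; rewrite H0.
  case: (dyP) => _ d0 _ _; have [u|u] := lerP t (2^-1).
    rewrite right1_le//.
    rewrite ifT; last lra.
    rewrite ifT; last lra.
    by case: fP => _ _ f1 _; rewrite f1 ?d0//; lra.
  rewrite right1_ge; last lra.
  rewrite ifT; last lra.
  rewrite ifF; last by apply/negP; lra.
  by congr dy; lra.
Qed.
End filling.

(** * Local connectedness, uniformly along a compact subspace *)

Section local_data.
Context {R : realType} {X : metricType R}.
Implicit Types (A : set X) (a x : X) (e r : R).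

Lemma lpc_subset A a e : locally_path_connected R (set_type A) -> A a -> 0 < e ->
  exists2 r, 0 < r & forall u v, ball a r u -> ball a r v -> A u -> A v ->
    exists c : R -> X, path_in (ball a e `&` A) u v c.
Proof.
move=> lpcA Aa e0.
pose a' : set_type A := exist _ a (mem_set Aa).
have ca : continuous (set_val : set_type A -> X) by exact: initial_continuous.
have [|V [Va VU Vpc]] := lpcA a' (set_val @^-1` (ball a e)^°).
  split; first by apply: open_comp => [? _|]; [exact: ca|exact: open_interior].
  exact: nbhsx_ballx.
(* The open set [V] of the subspace is the trace of an open set [W] of [X], which contains a
   ball. *)
case: Va => -[W oW WV] Va.
have Wa : nbhs a W.
  by apply: open_nbhs_nbhs; split => //; have : (set_val @^-1` W) a' by rewrite WV.
have /nbhs_ballP[r /= r0 rW] := Wa.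
exists r => // u v /rW Wu /rW Wv Au Av.
have Vu : V (exist _ u (mem_set Au)) by rewrite -WV.
have Vv : V (exist _ v (mem_set Av)) by rewrite -WV.
have [g gV] := Vpc _ _ Vu Vv.
exists (fun s => set_val (g (clampI s))).
have [cg g0 g1 gV'] := path_in_pathI gV.
split.
- exact: comp_continuous cg ca.
- by move=> s /g0 ->.
- by move=> s /g1 ->.
- move=> s; split; first by have := VU _ (gV' s); exact: interior_subset.
  exact: set_valP.
Qed.

(** The local hypotheses on [X] and [A] as one relation, antitone in [V] and monotone in [U], the
    shape required by [compact_uniform]. *)
Definition local_data A V U :=
  [/\ forall u v, V u -> V v -> exists c : R -> X, path_in U u v c,
      forall u v, V u -> V v -> A u -> A v ->
        exists c : R -> X, path_in (U `&` A) u v c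
    & @loops_contract_in R X V U].

Lemma local_data_sub A V V' U U' : V' `<=` V -> U `<=` U' ->
  local_data A V U -> local_data A V' U'.
Proof.
move=> V'V UU' [pU pA lc]; split.
- by move=> u v /V'V Vu /V'V /(pU _ _ Vu)[c cP]; exists c; exact: path_in_sub cP.
- move=> u v /V'V Vu /V'V Vv Au /(pA _ _ Vu Vv Au)[c cP]; exists c.
  by apply: path_in_sub cP; exact: setSI.
- move=> z g gV'; have [|H [cH HU H0 H1 He]] := lc z g; first exact: subset_trans V'V.
  by exists H; split => //; exact: subset_trans UU'.
Qed.

Lemma local_data_uniform A e : locally_1connected R X ->
  locally_path_connected R (set_type A) -> compact A -> 0 < e ->
  exists2 r, 0 < r & forall a, A a -> local_data A (ball a r) (ball a e).
Proof.
move=> [lpcX lscX] lpcA cA e0; apply: compact_uniform => //.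
  by move=> V V' U U'; exact: local_data_sub.
move=> a Aa; have e20 : 0 < e / 2 by lra.
have Ua : open_nbhs a (ball a (e / 2))^°.
  split; first exact: open_interior.
  exact: nbhsx_ballx.
have UU : (ball a (e / 2))^° `<=` ball a (e / 2) by exact: interior_subset.
have [V1 [/open_nbhs_nbhs/nbhs_ballP[r1 /= r10 V1a] V1U V1p]] := lpcX _ _ Ua.
have [r2 r20 r2p] := lpc_subset lpcA Aa e20.
have [V3 [/open_nbhs_nbhs/nbhs_ballP[r3 /= r30 V3a] V3U V3p]] := lscX _ _ Ua.
exists (Num.min r1 (Num.min r2 r3)); first by rewrite !lt_min r10 r20.
have rb u : ball a (Num.min r1 (Num.min r2 r3)) u ->
    [/\ ball a r1 u, ball a r2 u & ball a r3 u].
  by move=> /in_ball; rewrite !lt_min => /and3P[? ? ?]; split; exact/in_ball.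
split.
- move=> u v /rb[/V1a Vu _ _] /rb[/V1a Vv _ _]; have [g gV] := V1p _ _ Vu Vv.
  exists (fun s => g (clampI s)); apply: path_in_sub (path_in_pathI gV).
  exact: subset_trans UU.
- by move=> u v /rb[_ ? _] /rb[_ ? _]; exact: r2p.
- move=> z g gV; have [|H [cH HU H0 H1 He]] := V3p z g.
    by move=> x /gV /rb[_ _ /V3a].
  by exists H; split => //; exact: subset_trans UU.
Qed.

End local_data.

(** * Distance to a set *)

Section set_distance.
Context {R : realType} {X : metricType R} (A : set X).
Implicit Types (x y : X) (e : R).

Definition set_dist x : R := inf [set mdist x a | a in A].

Hypothesis A0 : A !=set0.

Lemma set_dist_lbound x : lbound [set mdist x a | a in A] 0.
Proof. by move=> _ [a _ <-]; exact: mdist_ge0. Qed.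

Lemma set_dist_le x a : A a -> set_dist x <= mdist x a.
Proof.
by move=> Aa; apply: ge_inf; [exists 0; exact: set_dist_lbound|exists a].
Qed.

Lemma set_dist_ge0 x : 0 <= set_dist x.
Proof.
apply: lb_le_inf; last exact: set_dist_lbound.
by have [a Aa] := A0; exists (mdist x a), a.
Qed.

Lemma set_dist_lt x e : set_dist x < e <-> exists2 a, A a & mdist x a < e.
Proof.
split=> [xe|[a Aa]]; last exact/le_lt_trans/set_dist_le.
have [|_ [a Aa <-] ?] := @inf_lt _ [set mdist x a | a in A] e _ xe; last by exists a.
by have [a Aa] := A0; exists (mdist x a), a.
Qed.

Lemma set_dist_triangle x y : set_dist x <= mdist x y + set_dist y.
Proof.
apply/ler_addgt0Pr => e e0.
have [|a Aa ya] := (set_dist_lt y (set_dist y + e)).1; first lra.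
have := set_dist_le x Aa; have := metric_triangle x y a; lra.
Qed.

Lemma set_dist_mem x : A x -> set_dist x = 0.
Proof.
move=> Ax; apply/eqP; rewrite eq_le set_dist_ge0 andbT.
by rewrite -(mdistxx x); exact: set_dist_le.
Qed.

Lemma set_dist_gt0 x : closed A -> ~ A x -> 0 < set_dist x.
Proof.
move=> clA nAx; have : nbhs x (~` A) by apply: open_nbhs_nbhs; split; rewrite ?openC.
move=> /nbhs_ballP[r /= r0 rA]; rewrite ltNge; apply/negP => xr.
have [|a Aa xa] := (set_dist_lt x r).1; first lra.
by apply: (rA a) => //; exact/in_ball.
Qed.

Lemma open_set_dist_lt e : open [set x | set_dist x < e].
Proof.
rewrite openE => x /= xe; apply/nbhs_ballP.
exists (e - set_dist x) => /=; first lra.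
move=> y /in_ball xy /=; have := set_dist_triangle y x.
rewrite metric_sym; lra.
Qed.

End set_distance.

(** * Pushing short paths into [A] *)

Section fillings.
Context {R : realType} {X : metricType R} (A : set X).
Hypothesis A0 : A !=set0.
Hypothesis X1 : locally_1connected R X.
Hypothesis lpcA : locally_path_connected R (set_type A).
Hypothesis cA : compact A.
Local Notation dist := (set_dist A).

Definition joins (g : X -> R -> X) x (e : R) :=
  exists2 b, A b & path_in (ball x e) x b (g x).

(** Close to [A], a point and some nearby [a] in [A] are joined by a short path; [choice_modulus]
    fixes these paths independently of [e]. *)
Lemma joins_modulus : exists g : X -> R -> X, forall e, 0 < e ->
  exists2 r, 0 < r & forall x, 0 < dist x -> dist x < r -> joins g x e.
Proof.
have [a0 Aa0] := A0.
have [||g gP] := @choice_modulus R X (R -> X) (fun=> a0) dist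
    (fun x g e => exists2 b, A b & path_in (ball x e) x b g).
- move=> x g e e' ee' [b Ab gP]; exists b => //; apply: path_in_sub gP.
  by move=> z /in_ball xz; apply/in_ball; exact: lt_le_trans ee'.
- move=> e e0; have e20 : 0 < e / 2 by lra.
  have [r r0 rP] := local_data_uniform X1 lpcA cA e20.
  exists (Num.min r (e / 2)); first by rewrite lt_min r0.
  move=> x _ /(set_dist_lt A0)[a Aa]; rewrite lt_min => /andP[xa xe].
  have [pU _ _] := rP _ Aa.
  have [||c cP] := pU x a; [by apply/in_ball; rewrite metric_sym|exact: ballxx|].
  exists c, a => //; apply: path_in_sub cP => z /in_ball az; apply/in_ball.
  by have := metric_triangle x a z; lra.
by exists g.
Qed.

(** The strict inequality at [s = t] keeps [f] off [A]; the factor 2 keeps the distances to [A]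
    along [f] comparable. *)
Definition short_path (f : R -> X) :=
  path_in setT (f 0) (f 1) f /\ forall s t, 2 * mdist (f s) (f t) < dist (f s).

Lemma short_path_gt0 f s : short_path f -> 0 < dist (f s).
Proof. by move=> [_ /(_ s s)]; rewrite mdistxx mulr0. Qed.

(** The sides depend on [f] only through its endpoints, so fillings of consecutive paths agree on
    their common side. The delay [2 * t - 1] is that of [square_filling]. *)
Definition fills (g : X -> R -> X) (f : R -> X) (K : R * R -> X) (e : R) :=
  [/\ continuous K, forall p, dist (K p) < e, forall s, K (s, 0) = f s,
      forall s, A (K (s, 1))
    & forall t, K (0, t) = g (f 0) (2 * t - 1) /\ K (1, t) = g (f 1) (2 * t - 1)].

(** The path [f], the two chosen sides and a path in [A] between their ends bound a square inside a
    ball where loops contract. [choice_modulus] makes one choice of fillings that approach [A] as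
    [f 0] does. *)
Lemma fillings_modulus (g : X -> R -> X) :
  (forall e, 0 < e -> exists2 r, 0 < r &
     forall x, 0 < dist x -> dist x < r -> joins g x e) ->
  exists K : (R -> X) -> R * R -> X, forall e, 0 < e ->
  exists2 r, 0 < r & forall f, short_path f -> dist (f 0) < r -> fills g f (K f) e.
Proof.
move=> gP; have [a0 Aa0] := A0.
have [||K KP] := @choice_modulus R _ _ (fun=> a0) (fun f => dist (f 0))
    (fun f K e => short_path f -> fills g f K e).
- move=> f K e e' ee' fP /fP[cK Ke K0 K1 Kg]; split => // p.
  exact: lt_le_trans (Ke p) ee'.
(* Loops within [r] of a point of [A] contract within [e] of it; points of [A] within [r1] are
   joined in [A] within [r / 2]. *)
- move=> e e0; have [r r0 rP] := local_data_uniform X1 lpcA cA e0.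
  have r20 : 0 < r / 2 by lra.
  have [r1 r10 r1P] := local_data_uniform X1 lpcA cA r20.
  (* The path [f], both side paths and [b'] lie within [3 * q] of [b]. *)
  pose q := Num.min r1 r / 8.
  have [qr1 qr] : 8 * q <= r1 /\ 8 * q <= r.
    by rewrite /q; case: (lerP r1 r) => ?; split; lra.
  have q0 : 0 < q by rewrite /q; case: (lerP r1 r) => ?; lra.
  have [r2 r20' r2P] := gP _ q0.
  (* Since [f] is short, [dist (f 1)] is below 3/2 of [dist (f 0)], hence below [r2]. *)
  exists (Num.min q (r2 / 2)); first by rewrite lt_min q0; lra.
  move=> f _; rewrite lt_min => /andP[xq xr2].
  have [fP|] := pselect (short_path f); last by exists (fun=> a0).
  case: (fP) => -[cf f0 f1 _] fd.
  have x0 := short_path_gt0 0 fP; have y0 := short_path_gt0 1 fP.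
  have y2 : dist (f 1) < r2.
    have := set_dist_triangle A0 (f 1) (f 0); have := fd 0 1.
    by rewrite metric_sym; lra.
  have [b Ab gx] : joins g (f 0) q by apply: r2P => //; lra.
  have [b' Ab' gy] : joins g (f 1) q by exact: r2P.
  have bx : mdist b (f 0) < q.
    by case: gx => _ _ /(_ 1 (lexx _)) {1}<- /(_ 1)/in_ball; rewrite metric_sym.
  have yb' : mdist (f 1) b' < q.
    by case: gy => _ _ /(_ 1 (lexx _)) {1}<- /(_ 1)/in_ball.
  have fs s : mdist (f 0) (f s) < q by have := fd 0 s; lra.
  have tri := @metric_triangle R X.
  have bb' : ball b r1 b'.
    apply/in_ball; have := fs 1; have := tri b (f 0) b'.
    by have := tri (f 0) (f 1) b'; lra.
  have [_ pA _] := r1P _ Ab.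
  have [c cP] := pA _ _ (ballxx _ r10) bb' Ab Ab'.
  have [_ _ lc] := rP _ Ab.
  have [||||K [cK KU K0 K1 Kg]] := @square_filling _ _ _ _ (f 0) (f 1) b b' f (g (f 0)) (g (f 1)) c lc.
  + split => // s; apply/in_ball; have := tri b (f 0) (f s); have := fs s; lra.
  + apply: path_in_sub gx => z /in_ball ?; apply/in_ball.
    by have := tri b (f 0) z; lra.
  + apply: path_in_sub gy => z /in_ball ?; apply/in_ball.
    have := tri b (f 0) z; have := tri (f 0) (f 1) z; have := fs 1; lra.
  + by apply: path_in_sub cP => z [/in_ball ? _]; apply/in_ball; lra.
  exists K => _; split => //.
  + move=> p; apply/(set_dist_lt A0); exists b => //.
    by rewrite metric_sym; apply/in_ball; exact: KU.
  + by move=> s; rewrite K1; case: cP => _ _ _ /(_ s)[].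
exists K => e e0; have [r r0 rP] := KP _ e0; exists r => // f fP fr.
by apply: rP => //; exact: short_path_gt0.
Qed.

End fillings.

(** * Tilings by maximal dyadic intervals *)

Section dyadic_tiling.
Context {R : realType}.
Implicit Types (m : nat) (k : int) (s : R).

Definition dyl m k : R := k%:~R / 2 ^+ m.
Definition dyr m k : R := dyl m (k + 1).

Lemma dyl_lt_dyr m k : dyl m k < dyr m k.
Proof. by rewrite ltr_pM2r ?invr_gt0 ?exprn_gt0// ltr_int; lia. Qed.

Lemma dyadic_parent m k :
  dyl m (k %/ 2)%Z <= dyl m.+1 k /\ dyr m.+1 k <= dyr m (k %/ 2)%Z.
Proof.
have dyE j : dyl m j = dyl m.+1 (2 * j).
  by rewrite /dyl intrM exprS; field; rewrite expf_neq0.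
rewrite /dyr !dyE !ler_pM2r ?invr_gt0 ?exprn_gt0// !ler_int; lia.
Qed.

Lemma dyadic_refine m d k : dyl m k = dyl (m + d) (k * 2 ^+ d).
Proof.
rewrite /dyl intrM exprD rmorphXn /=; field.
by rewrite !expf_neq0.
Qed.

Context (good : R -> R -> Prop).
Hypothesis good_sub : forall l r l' r', l <= l' -> r' <= r -> good l r -> good l' r'.

(** Maximality among dyadic intervals of length at most 1: goodness passes to subintervals, so
    testing the parent suffices. *)
Definition tile m k := good (dyl m k) (dyr m k) /\
  (if m is m'.+1 then ~ good (dyl m' (k %/ 2)%Z) (dyr m' (k %/ 2)%Z) else True).

(** Overlapping dyadic intervals are nested. If the levels differ, the parent of the smaller one
    still lies in the larger one, hence is good, against maximality. *)
Lemma tile_overlap_le m k m' k' : (m <= m')%N -> tile m k -> tile m' k' ->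
  dyl m k < dyr m' k' -> dyl m' k' < dyr m k -> m = m' /\ k = k'.
Proof.
move=> /subnKC <-; move: (m' - m)%N => {m'} d [mk _] [_ +].
rewrite /dyr !(dyadic_refine m d) !ltr_pM2r ?invr_gt0 ?exprn_gt0// !ltr_int.
case: d => [|d]; first by rewrite addn0 expr0 => _ ? ?; split => //; lia.
rewrite addnS => ngood k1 k2; exfalso; apply: ngood; move: mk; apply: good_sub.
  rewrite (dyadic_refine m d) ler_pM2r ?invr_gt0 ?exprn_gt0// ler_int.
  by move: k1; rewrite exprS; move: (2 ^+ d) => e; lia.
rewrite /dyr (dyadic_refine m d) ler_pM2r ?invr_gt0 ?exprn_gt0// ler_int.
by move: k2; rewrite exprS; move: (2 ^+ d) => e; lia.
Qed.

Lemma tile_overlap m k m' k' s : tile m k -> tile m' k' ->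
  dyl m k <= s <= dyr m k -> dyl m' k' <= s <= dyr m' k' ->
  [\/ m = m' /\ k = k', s = dyl m k /\ s = dyr m' k' | s = dyr m k /\ s = dyl m' k'].
Proof.
move=> tmk tmk' /andP[ls sr] /andP[ls' sr'].
have lr := dyl_lt_dyr m k; have lr' := dyl_lt_dyr m' k'.
have [lr1|] := ltP (dyl m k) (dyr m' k'); last by constructor 2; split; lra.
have [lr2|] := ltP (dyl m' k') (dyr m k); last by constructor 3; split; lra.
constructor 1; have [mm'|/ltnW m'm] := leqP m m'; first exact: tile_overlap_le.
by have [-> ->] := tile_overlap_le m'm tmk' tmk lr2 lr1.
Qed.

(** Passing to the parent while it is good stops at a tile, at level 0 at the latest. *)
Lemma good_tile m k : good (dyl m k) (dyr m k) ->
  exists m' k', [/\ tile m' k', dyl m' k' <= dyl m k & dyr m k <= dyr m' k'].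
Proof.
elim: m k => [|m IH] k gk; first by exists 0%N, k.
have [gp|ngp] := pselect (good (dyl m (k %/ 2)%Z) (dyr m (k %/ 2)%Z)).
  have [m' [k' [t l r]]] := IH _ gp; have [pl pr] := dyadic_parent m k.
  by exists m', k'; split => //; [exact: le_trans pl|exact: le_trans r].
by exists m.+1, k.
Qed.

(** The two tiles, possibly equal, cover a neighborhood of [s], as continuity at [s] requires. *)
Lemma tiles_around s d : 0 < d ->
  (forall l r, s - d < l -> l <= s -> s <= r -> r < s + d -> good l r) ->
  exists m k m' k', [/\ tile m k, tile m' k', dyl m k < s <= dyr m k
    & dyl m' k' <= s < dyr m' k'].
Proof.
move=> d0 gd.
have [m md] : exists m, (2 ^+ m)^-1 < d.
  have [m _ /(_ m (leqnn _))] := near_infty_natSinv_expn_lt (PosNum d0).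
  by exists m; rewrite -div1r.
have p0 : 0 < 2 ^+ m :> R by rewrite exprn_gt0.
have dyrE k : dyr m k = dyl m k + (2 ^+ m)^-1.
  by rewrite /dyr /dyl intrD mulrDl mul1r.
(* The two roundings differ when [s] is dyadic of level [m]: the first interval then ends at [s],
   the second starts there. *)
have [kl [kl1 kl2]] : exists k, dyl m k < s /\ s <= dyr m k.
  exists (Num.ceil (s * 2 ^+ m) - 1); rewrite /dyr /dyl subrK.
  by rewrite ltr_pdivrMr// ler_pdivlMr// ceilB1_lt ceil_ge.
have [kr [kr1 kr2]] : exists k, dyl m k <= s /\ s < dyr m k.
  exists (Num.floor (s * 2 ^+ m)); rewrite /dyr /dyl.
  by rewrite ler_pdivrMr// ltr_pdivlMr// floor_le floorD1_gt.
have [|m1 [k1 [t1 l1 r1]]] := @good_tile m kl.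
  by apply: gd; move: kl1 kl2; rewrite ?dyrE; lra.
have [|m2 [k2 [t2 l2 r2]]] := @good_tile m kr.
  by apply: gd; move: kr1 kr2; rewrite ?dyrE; lra.
exists m1, k1, m2, k2; split => //; apply/andP; split; lra.
Qed.

End dyadic_tiling.

(** * Deforming a path near a collapsed set to the point [star] *)

Section deformation.
Context {R : realType} {X : metricType R} {Y : topologicalType} (A : set X).
Context (p : X -> Y) (star : Y) (g : X -> R -> X) (K : (R -> X) -> R * R -> X).
Context (w : R -> X) (r1 : R).
Implicit Types l r s t u e : R.
Local Notation dist := (set_dist A).
Hypothesis A0 : A !=set0.
Hypothesis clA : closed A.
Hypothesis cp : continuous p.
Hypothesis pA : forall x, A x -> p x = star.
Hypothesis nbhs_star : forall W, nbhs star W ->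
  exists2 e, 0 < e & forall x, dist x < e -> W (p x).
Hypothesis KP : forall e, 0 < e -> exists2 r, 0 < r &
  forall f, short_path A f -> dist (f 0) < r -> fills A g f (K f) e.
Hypothesis r1P :
  forall f, short_path A f -> dist (f 0) < r1 -> fills A g f (K f) 1.
Hypothesis w_near : forall s, dist (w s) < r1.
Hypothesis w_cont : forall s, ~ A (w s) -> w @ s --> w s.
Hypothesis w_dist : continuous (fun s => dist (w s)).

Definition short_on l r := forall s t, l <= s <= r -> l <= t <= r ->
  2 * mdist (w s) (w t) < dist (w s).

Lemma short_on_sub l r l' r' : l <= l' -> r' <= r -> short_on l r -> short_on l' r'.
Proof.
by move=> ll' rr' lr s t /andP[s1 s2] /andP[t1 t2]; apply: lr; apply/andP; split; lra.
Qed.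

Lemma short_on_notin l r s : short_on l r -> l <= s <= r -> ~ A (w s).
Proof.
by move=> /[swap] lsr /(_ _ _ lsr lsr); rewrite mdistxx mulr0 => /[swap] /set_dist_mem->; rewrite ?ltxx.
Qed.

Lemma short_on_near s : ~ A (w s) -> exists2 d, 0 < d &
  forall l r, s - d < l -> l <= s -> s <= r -> r < s + d -> short_on l r.
Proof.
move=> ns; have e0 := set_dist_gt0 A0 clA ns.
(* Within an eighth of [dist (w s)] from [w s], two values differ by less than a quarter of it,
   while their distances to [A] exceed seven eighths. *)
have e8 : 0 < dist (w s) / 8 by lra.
have /(@cvg_ball _ _ _ _ _ _) /(_ _ e8) := w_cont ns.
move=> /nbhs_ballP[d /= d0 dP]; exists d => // l r sl ls sr rs u v lu lv.
have wd u' : l <= u' <= r -> mdist (w s) (w u') < dist (w s) / 8.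
  move=> /andP[? ?]; apply/in_ball; apply: dP.
  by rewrite /ball/= ltr_norml; apply/andP; split; lra.
have := wd _ lu; have := wd _ lv; have := set_dist_triangle A0 (w s) (w u).
have := metric_triangle (w u) (w s) (w v); rewrite (metric_sym (w u) (w s)); lra.
Qed.

Definition piece l r (u : R) : X := w (l + (r - l) * clamp u).

Lemma piece_in l r u : l <= r -> l <= l + (r - l) * clamp u <= r.
Proof.
move=> lr; have u0 := clamp_ge0 u; have u1 := clamp_le1 u.
by apply/andP; split; nra.
Qed.

Lemma short_piece l r : l <= r -> short_on l r -> short_path A (piece l r).
Proof.
move=> lr slr; split; last by move=> s t; apply: slr; exact: piece_in.
split => //.
- move=> u.
  have := w_cont (short_on_notin slr (piece_in u lr)).
  apply: (@continuous_comp _ _ _ (fun v : R => l + (r - l) * clamp v) w).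
  apply: continuous_addr; first exact: continuous_cstr.
  apply: continuous_mulr; first exact: continuous_cstr.
  by apply: continuous_clamp => ?; exact: cvg_id.
- by move=> s s0; rewrite /piece clamp_le0// clamp0.
- by move=> s s1; rewrite /piece clamp_ge1// clamp1.
Qed.

Definition piece_homotopy l r (q : R * R) : Y :=
  p (K (piece l r) ((q.1 - l) / (r - l), q.2)).

Lemma piece_homotopyP l r : l < r -> short_on l r ->
  [/\ continuous (piece_homotopy l r),
      forall s, l <= s <= r -> piece_homotopy l r (s, 0) = p (w s),
      forall s, piece_homotopy l r (s, 1) = star,
      forall t, piece_homotopy l r (l, t) = p (g (w l) (2 * t - 1))
    & forall t, piece_homotopy l r (r, t) = p (g (w r) (2 * t - 1))].
Proof.
move=> lr slr; have rl0 : r - l != 0 by rewrite subr_eq0 gt_eqF.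
have pl : piece l r 0 = w l by rewrite /piece clamp0 mulr0 addr0.
have pr : piece l r 1 = w r by rewrite /piece clamp1 mulr1 addrC subrK.
have [|cK _ K0 K1 Kg] := r1P (short_piece (ltW lr) slr); first by rewrite pl.
rewrite /piece_homotopy; split => /=.
- apply: comp_continuous cp; apply: comp_continuous cK.
  apply: pair_continuous; last exact: snd_continuous.
  apply: continuous_mulr; last exact: continuous_cstr.
  by apply: continuous_subr; [exact: fst_continuous|exact: continuous_cstr].
- move=> s /andP[ls sr]; rewrite K0 /piece clamp_id.
  + by congr (p (w _)); field.
  + by rewrite divr_ge0//; lra.
  + by rewrite ler_pdivrMr; lra.
- by move=> s; rewrite pA.
- by move=> t; rewrite subrr mul0r (Kg t).1 pl.
- by move=> t; rewrite divff// (Kg t).2 pr.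
Qed.

Local Notation tile := (tile short_on).
Local Notation tile_homotopy mk := (piece_homotopy (dyl mk.1 mk.2) (dyr mk.1 mk.2)).

(** Distinct tiles meet only in a common endpoint, and there both fillings restrict to the side
    given by [g] at that point. *)
Lemma tile_homotopy_eq m k m' k' s t : tile m k -> tile m' k' ->
  dyl m k <= s <= dyr m k -> dyl m' k' <= s <= dyr m' k' ->
  piece_homotopy (dyl m k) (dyr m k) (s, t) =
  piece_homotopy (dyl m' k') (dyr m' k') (s, t).
Proof.
move=> tmk tmk' smk smk'.
have [_ _ _ Hl Hr] := piece_homotopyP (dyl_lt_dyr m k) tmk.1.
have [_ _ _ Hl' Hr'] := piece_homotopyP (dyl_lt_dyr m' k') tmk'.1.
case: (tile_overlap short_on_sub tmk tmk' smk smk') => [[-> ->]//|[sl sr]|[sr sl]].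
  by rewrite {1}sl Hl sr Hr' -sr -sl.
by rewrite {1}sr Hr sl Hl' -sr -sl.
Qed.

(** The tile is picked by choice; by [tile_homotopy_eq] every tile containing [q.1] gives the same
    value. Times at which [w] is in [A] lie in no tile. *)
Definition deformation (q : R * R) : Y :=
  if pselect (exists mk, tile mk.1 mk.2 /\ dyl mk.1 mk.2 <= q.1 <= dyr mk.1 mk.2)
    is left ex then tile_homotopy (projT1 (cid ex)) q else star.

Lemma deformation_tile m k s t : tile m k -> dyl m k <= s <= dyr m k ->
  deformation (s, t) = piece_homotopy (dyl m k) (dyr m k) (s, t).
Proof.
move=> tmk smk; rewrite /deformation; case: pselect => [ex|[]]; last by exists (m, k).
by case: cid => -[m' k'] /= [? ?]; exact: tile_homotopy_eq.
Qed.

Lemma deformation_star s t : A (w s) -> deformation (s, t) = star.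
Proof.
rewrite /deformation; case: pselect => // -[[m k] /= [tmk smk]] Aws.
by have := short_on_notin tmk.1 smk.
Qed.

Lemma tiles_around_notin s : ~ A (w s) -> exists m k m' k',
  [/\ tile m k, tile m' k', dyl m k < s <= dyr m k & dyl m' k' <= s < dyr m' k'].
Proof.
move=> /short_on_near[d d0 dP]; exact: tiles_around dP.
Qed.

(** A tile containing [s] starts at a point whose distance to [A] is below 3/2 of [dist (w s)],
    hence below [r], so its filling stays within [e] of [A]. This makes the extension by [star]
    continuous. *)
Lemma deformation_dist e : 0 < e -> exists2 r, 0 < r & forall s t,
  dist (w s) < r -> deformation (s, t) = star \/
    exists2 x, dist x < e & deformation (s, t) = p x.
Proof.
move=> e0; have [r r0 rP] := KP e0; exists (r / 2); first lra.
move=> s t sr; have [As|/tiles_around_notin[m [k [_ [_ [tmk _ /andP[ls sr'] _]]]]]] := pselect (A (w s)).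
  by left; exact: deformation_star.
right; rewrite (deformation_tile t tmk) ?ls ?(ltW ls)//.
have lr : dyl m k < dyr m k :> R by exact: dyl_lt_dyr.
have [|_ Ke _ _ _] := rP _ (short_piece (ltW lr) tmk.1); last first.
  by rewrite /piece_homotopy; move: (_, _) => q; exists (K (piece (dyl m k) (dyr m k)) q).
rewrite /piece clamp0 mulr0 addr0.
have /(_ s (dyl m k)) := tmk.1; rewrite lexx (ltW lr) (ltW ls) sr' => /(_ isT isT).
have := set_dist_triangle A0 (w (dyl m k)) (w s); rewrite metric_sym; lra.
Qed.

Lemma deformation_continuous : continuous deformation.
Proof.
move=> [s t]; have [As|] := pselect (A (w s)).
  rewrite /continuous_at (deformation_star t As) => W Wstar.
  have [e e0 eW] := nbhs_star Wstar.
  have [r r0 rP] := deformation_dist e0.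
  have : nbhs s [set u | dist (w u) < r].
    have /w_dist// : nbhs (dist (w s)) [set d | d < r].
    by apply: open_nbhs_nbhs; split; [exact: open_lt|rewrite /= set_dist_mem].
  move=> sr; exists ([set u | dist (w u) < r], setT).
    by split => //; exact: filterT.
  move=> [u v] [/= ur _]; have [->|[x /eW Wx ->]//] := rP u v ur.
  exact: nbhs_singleton.
(* Off [A], the tiles to the left and to the right of [s] cover a neighborhood, and the deformation
   is continuous on each. *)
move=> /tiles_around_notin[m [k [m' [k' [tmk tmk' /andP[l1 r1'] /andP[l2 r2]]]]]].
have [c1 _ _ _ _] := piece_homotopyP (dyl_lt_dyr m k) tmk.1.
have [c2 _ _ _ _] := piece_homotopyP (dyl_lt_dyr m' k') tmk'.1.
move=> W WH.
have W1 : nbhs (s, t) (piece_homotopy (dyl m k) (dyr m k) @^-1` W).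
  by apply: c1; rewrite -(deformation_tile t tmk)// (ltW l1).
have W2 : nbhs (s, t) (piece_homotopy (dyl m' k') (dyr m' k') @^-1` W).
  by apply: c2; rewrite -(deformation_tile t tmk')// l2 ltW.
have W3 : nbhs (s, t) [set q : R * R | dyl m k < q.1 < dyr m' k'].
  exists ([set u : R | dyl m k < u < dyr m' k'], setT); last by move=> q [].
  split; last exact: filterT.
  have := @near_in_itvoo R (dyl m k) (dyr m' k') s.
  rewrite in_itv /= l1 r2 => /(_ isT); apply: filterS => u.
  by rewrite /= in_itv.
apply: filterS (filterI W3 (filterI W1 W2)) => -[u v] [/= /andP[lu ur] [Wu1 Wu2]].
have [us|su] := leP u s.
  by rewrite (deformation_tile v tmk)// (ltW lu)/=; exact: le_trans r1'.
by rewrite (deformation_tile v tmk')// (ltW ur) andbT; exact: le_trans (ltW su).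
Qed.

Lemma deformation0 s : deformation (s, 0) = p (w s).
Proof.
have [As|/tiles_around_notin[m [k [_ [_ [tmk _ /andP[ls sr'] _]]]]]] := pselect (A (w s)).
  by rewrite deformation_star// pA.
have [_ H0 _ _ _] := piece_homotopyP (dyl_lt_dyr m k) tmk.1.
by rewrite (deformation_tile 0 tmk) ?H0 ?(ltW ls).
Qed.

Lemma deformation1 s : deformation (s, 1) = star.
Proof.
have [As|/tiles_around_notin[m [k [_ [_ [tmk _ /andP[ls sr'] _]]]]]] := pselect (A (w s)).
  by rewrite deformation_star.
have [_ _ H1 _ _] := piece_homotopyP (dyl_lt_dyr m k) tmk.1.
by rewrite (deformation_tile 1 tmk) ?H1 ?(ltW ls).
Qed.

(** Tiles have length at most 1 and dyadic endpoints, so the integer 0 is interior to none: the tile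
    on its right starts at 0. The same argument applies to 1. *)
Lemma deformation_left t : ~ A (w 0) -> deformation (0, t) = p (g (w 0) (2 * t - 1)).
Proof.
move=> /tiles_around_notin[_ [_ [m [k [_ tmk _ /andP[ls sr]]]]]].
have [_ _ _ Hl _] := piece_homotopyP (dyl_lt_dyr m k) tmk.1.
have l0 : dyl m k = 0 :> R.
  move: ls sr; rewrite /dyr /dyl pmulr_lle0 ?invr_gt0 ?exprn_gt0//.
  rewrite pmulr_lgt0 ?invr_gt0 ?exprn_gt0// -[0]/(0%:~R) ler_int ltr_int => k0 k1.
  have -> : k = 0 by lia.
  by rewrite mul0r.
by have := Hl t; rewrite l0 => <-; rewrite (deformation_tile t tmk) l0// lexx ltW.
Qed.

Lemma deformation_right t : ~ A (w 1) -> deformation (1, t) = p (g (w 1) (2 * t - 1)).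
Proof.
move=> /tiles_around_notin[m [k [_ [_ [tmk _ /andP[ls sr] _]]]]].
have [_ _ _ _ Hr] := piece_homotopyP (dyl_lt_dyr m k) tmk.1.
have r0 : dyr m k = 1 :> R.
  move: ls sr; rewrite /dyr /dyl ltr_pdivrMr ?exprn_gt0// ler_pdivlMr ?exprn_gt0//.
  rewrite !mul1r -[2]/(2%:~R) -rmorphXn /= ltr_int ler_int => k0 k1.
  have -> : k + 1 = 2 ^+ m by lia.
  by rewrite rmorphXn /= divff// expf_neq0.
by have := Hr t; rewrite r0 => <-; rewrite (deformation_tile t tmk) r0// lexx ltW.
Qed.

End deformation.

(** * Induction along the unit interval *)

Lemma interval_induction (R : realType) (P : R -> R -> Prop) :
  (forall u v w, u < v -> v < w -> P u v -> P v w -> P u w) ->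
  (forall s, 0 <= s <= 1 -> exists2 d, 0 < d &
     forall u v, s - d < u -> u < v -> v < s + d -> P u v) ->
  P 0 1.
Proof.
move=> Pcat Ploc.
(* The times reached from 0. The time 0 is added separately, because [P] is given only on
   nondegenerate intervals. *)
pose E := [set s : R | 0 <= s <= 1 /\ (s = 0 \/ 0 < s /\ P 0 s)].
have E0 : E 0 by split; [rewrite lexx ler01|left].
have E1 : ubound E 1 by move=> s [/andP[]].
have sE : has_sup E by split; [exists 0|exists 1].
have sup0 : 0 <= sup E by apply: ub_le_sup => //; exists 1.
have sup1 : sup E <= 1 by apply: ge_sup => //; exists 0.
have [|d d0 dP] := Ploc (sup E); first by rewrite sup0.
have [s [/andP[s0 s1] Ps] ss] := sup_adherent d0 sE.
have ssup : s <= sup E by apply: ub_le_sup; [exists 1|split; rewrite ?s0].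
(* A reachable time beyond [sup E] unless capped by 1; hence it equals 1. *)
pose v := Num.min 1 (sup E + d / 2).
have v0 : 0 < v by rewrite lt_min ltr01; lra.
have sv : s <= v by rewrite le_min s1/=; lra.
have vd : v < sup E + d by rewrite gt_min; apply/orP; right; lra.
have Pv : P 0 v.
  move: sv; rewrite le_eqVlt => /predU1P[sv|sv].
    by case: Ps => [s00|[_]]; [move: v0; rewrite -sv s00 ltxx|rewrite sv].
  have Psv : P s v by exact: dP.
  by case: Ps Psv => [->//|[s0' P0s] Psv]; exact: Pcat Psv.
have : v <= sup E.
  apply: ub_le_sup; first by exists 1.
  by split; [rewrite ltW//= ge_min lexx|right].
by move: Pv; rewrite /v; case: (lerP 1 (sup E + d / 2)) => // ? _ ?; exfalso; lra.
Qed.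

(** * Lifts up to homotopy *)

Section lifting.
Context {R : realType} {X Y : topologicalType} (p : X -> Y).
Implicit Types (a : R -> Y) (u v s t : R).

(** The ends [x] and [y] of the lift are prescribed, so that lifts over adjacent intervals can be
    glued. *)
Definition homotopic_to_lift a u v x y := exists (b : R -> X) (H : R * R -> Y),
  [/\ continuous b, b u = x /\ b v = y, continuous H,
      forall s, u <= s <= v -> H (s, 0) = a s /\ H (s, 1) = p (b s)
    & forall t, H (u, t) = a u /\ H (v, t) = a v].

Lemma homotopic_to_lift_cat a u v w x y z : u <= v -> v <= w ->
  homotopic_to_lift a u v x y -> homotopic_to_lift a v w y z ->
  homotopic_to_lift a u w x z.
Proof.
move=> uv vw [b [H [cb [bu bv] cH Hs He]]] [b' [H' [cb' [bv' bw] cH' Hs' He']]].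
have cid : continuous (fun s : R => s) by move=> ?; exact: cvg_id.
exists (fun s => if s <= v then b s else b' s).
exists (fun q => if q.1 <= v then H q else H' q); split.
- by apply: continuous_if_le => // s ->; rewrite bv bv'.
- rewrite uv bu; split => //; case: lerP => // wv.
  by rewrite -bw (_ : w = v) ?bv ?bv'//; lra.
- apply: continuous_if_le => //; first exact: fst_continuous.
  by move=> [s t] /= ->; rewrite (He t).2 (He' t).1.
- move=> s /andP[us sw] /=; case: lerP => sv; first by apply: Hs; rewrite us.
  by apply: Hs'; rewrite sw ltW.
- move=> t /=; rewrite uv (He t).1; split => //; case: lerP => wv; last exact: (He' t).2.
  have -> : w = v by lra.
  by rewrite (He t).2.
Qed.

Lemma homotopic_to_lift_rescale a u v x y : u < v ->
  homotopic_to_lift (fun s => a (u + (v - u) * clamp s)) 0 1 x y ->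
  homotopic_to_lift a u v x y.
Proof.
move=> uv [b [H [cb [b0 b1] cH Hs He]]].
have vu : v - u != 0 by rewrite subr_eq0 gt_eqF.
have cid : continuous (fun s : R => s) by move=> ?; exact: cvg_id.
have cst (T : topologicalType) (c : R) : continuous (fun _ : T => c) by exact: continuous_cstr.
exists (fun s => b ((s - u) / (v - u))).
exists (fun q => H ((q.1 - u) / (v - u), q.2)); split => /=.
- by apply: comp_continuous cb; apply: continuous_mulr => //; exact: continuous_subr.
- by rewrite subrr mul0r divff.
- apply: comp_continuous cH; apply: pair_continuous; last exact: snd_continuous.
  apply: continuous_mulr => //; apply: continuous_subr => //; exact: fst_continuous.
- move=> s /andP[us sv].
  have s01 : 0 <= (s - u) / (v - u) <= 1.
    by rewrite divr_ge0 ?ler_pdivrMr ?mul1r//=; lra.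
  have [-> ->] := Hs _ s01; split => //.
  by case/andP: s01 => ? ?; rewrite clamp_id//; congr a; field.
- move=> t; rewrite subrr mul0r divff//; have [-> ->] := He t.
  by rewrite clamp0 clamp1 mulr0 mulr1 addr0 addrC subrK.
Qed.

(* The lift of [a], the bottom side of [D], runs along the three other sides. *)
Lemma homotopic_to_lift_square a (A : set X) star x x' y y' (c d e : R -> X) (D : R * R -> Y) :
  continuous D -> (forall s, D (s, 0) = a s) -> (forall s, D (s, 1) = star) ->
  (forall z, A z -> p z = star) ->
  path_in setT x x' d -> path_in setT y y' e -> path_in A x' y' c ->
  (forall t, D (0, t) = p (d t)) -> (forall t, D (1, t) = p (e t)) ->
  homotopic_to_lift a 0 1 x y.
Proof.
move=> cD D0 D1 pA [cd d0 d1 _] [ce e0 e1 _] [cc c0 c1 cA] Dl Dr.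
have cid : continuous (fun s : R => s) by move=> ?; exact: cvg_id.
have cst (T : topologicalType) (r : R) : continuous (fun _ : T => r) by exact: continuous_cstr.
(* By thirds of [s]: up the left side, along the top, down the right side. *)
pose W1 s := clamp (3 * s - 1).
pose W2 s := Num.min 1 (Num.min (3 * s) (3 - 3 * s)).
have cW1 : continuous W1.
  by apply: continuous_clamp; apply: continuous_subr => //; exact: continuous_mulr.
have cW2 : continuous W2.
  apply: continuous_minr => //; apply: continuous_minr; first exact: continuous_mulr.
  by apply: continuous_subr => //; exact: continuous_mulr.
exists (fun s => if s <= 3^-1 then d (3 * s) else if s <= 2 / 3 then c (3 * s - 1) else e (3 - 3 * s)).
(* The straight-line homotopy in the square from the bottom side to this route, composed with
   [D]. *)
exists (fun q => D ((1 - q.2) * q.1 + q.2 * W1 q.1, q.2 * W2 q.1)); split => /=.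
- apply: continuous_if_le => //.
  + by apply: comp_continuous cd; exact: continuous_mulr.
  + apply: continuous_if_le => //.
    * by apply: comp_continuous cc; apply: continuous_subr => //; exact: continuous_mulr.
    * by apply: comp_continuous ce; apply: continuous_subr => //; exact: continuous_mulr.
    * by move=> s ->; rewrite c1 ?e1//; lra.
  + by move=> s ->; rewrite ifT; [rewrite d1 ?c0//|]; lra.
- rewrite ifT; last lra.
  rewrite ifF; last by apply/negP; lra.
  rewrite ifF; last by apply/negP; lra.
  by rewrite d0 ?e0//; lra.
- apply: comp_continuous cD; apply: pair_continuous.
    apply: continuous_addr; apply: continuous_mulr.
    + by apply: continuous_subr => //; exact: snd_continuous.
    + exact: fst_continuous.
    + exact: snd_continuous.
    + by apply: comp_continuous cW1; exact: fst_continuous.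
  apply: continuous_mulr; first exact: snd_continuous.
  by apply: comp_continuous cW2; exact: fst_continuous.
- move=> s /andP[s0 s1]; rewrite subr0 subrr !mul0r !mul1r addr0 add0r D0.
  split => //; rewrite /W1 /W2; case: lerP => s3.
    rewrite clamp_le0; last lra.
    rewrite Dl; congr (p (d _)); minmax.
  case: lerP => s4.
    rewrite pA//; have -> : Num.min 1 (Num.min (3 * s) (3 - 3 * s)) = 1 by minmax.
    exact: D1.
  rewrite clamp_ge1; last lra.
  rewrite Dr; congr (p (e _)); minmax.
- move=> t; have -> : W1 0 = 0 by rewrite /W1 clamp_le0//; lra.
  have -> : W1 1 = 1 by rewrite /W1 clamp_ge1//; lra.
  have -> : W2 0 = 0 by rewrite /W2; minmax.
  have -> : W2 1 = 0 by rewrite /W2; minmax.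
  by rewrite !mulr0 !mulr1 addr0 subrK !D0.
Qed.

End lifting.

(** * Delayed paths, and paths in a connected set *)

Lemma path_in_delay (R : realType) (T : topologicalType) (V : set T) x y (f : R -> T) :
  path_in V x y f -> path_in V x y (fun t => f (2 * t - 1)).
Proof.
move=> [cf f0 f1 fV]; split => //.
- by apply: comp_continuous cf; exact: affine_continuous.
- by move=> s s0; rewrite f0//; lra.
- by move=> s s1; rewrite f1//; lra.
Qed.

(** The set of points joined to [u] inside [A] is both open and closed in [A]. *)
Lemma connected_lpc_joined (R : realType) (X : metricType R) (A : set X) :
  connected A -> locally_path_connected R (set_type A) ->
  forall u v, A u -> A v -> exists c : R -> X, path_in A u v c.
Proof.
move=> conA lpcA u v Au Av.
pose joined x y := exists c : R -> X, path_in A x y c.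
have joined_near x : A x -> exists V, [/\ open V, V x &
    forall y, V y -> A y -> joined x y /\ joined y x].
  move=> Ax; have [r r0 rP] := lpc_subset lpcA Ax (@ltr01 R).
  exists (ball x r)^°; split; [exact: open_interior|exact: nbhsx_ballx|].
  move=> y /interior_subset xy Ay; split.
    by have [c cP] := rP _ _ (ballxx _ r0) xy Ax Ay; exists c; apply: path_in_sub cP => z [].
  by have [c cP] := rP _ _ xy (ballxx _ r0) Ay Ax; exists c; apply: path_in_sub cP => z [].
have joined_trans x y z : joined x y -> joined y z -> joined x z.
  by move=> [c cP] [c' c'P]; eexists; exact: path_in_cat cP c'P.
suff /seteqP[_ /(_ v Av)[]] : [set y | A y /\ joined u y] = A by [].
apply: conA.
- by exists u; split => //; exists (fun=> u); exact: path_in_cst.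
- exists (\bigcup_(V in [set V | open V /\ forall y, V y -> A y -> joined u y]) V).
    by apply: bigcup_open => V [].
  apply/seteqP; split => [y [Ay uy]|y [Ay [V [_ VP] Vy]]]; last by split => //; exact: VP.
  split => //; have [V [oV Vy VP]] := joined_near _ Ay; exists V => //; split => // z Vz Az.
  by apply: joined_trans uy _; have [] := VP _ Vz Az.
- exists (~` \bigcup_(V in [set V | open V /\ forall y, V y -> A y -> ~ joined u y]) V).
    by rewrite closedC; apply: bigcup_open => V [].
  apply/seteqP; split => [y [Ay uy]|y [Ay nVy]].
    by split => // -[V [_ VP] Vy]; exact: VP uy.
  split => //; apply: contrapT => nuy; apply: nVy.
  have [V [oV Vy VP]] := joined_near _ Ay; exists V => //; split => // z Vz Az uz.
  by apply: nuy; apply: joined_trans uz _; have [] := VP _ Vz Az.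
Qed.

(** * Lifting paths through the collapse map *)

Section collapse_lifting.
Context (R : realType) (X : metricType R) (n : nat) (A : 'I_n -> set X).
Hypothesis disjA : trivIset [set: 'I_n] A.
Hypothesis X1 : locally_1connected R X.
Hypothesis A_connected : forall i, connected (A i).
Hypothesis A_lpc : forall i, locally_path_connected R (set_type (A i)).
Hypothesis A_compact : forall i, compact (A i).
Local Notation Y := (collapse disjA).
Local Notation p := (collapse_map disjA : X -> Y).
Local Notation dist i := (set_dist (A i)).

Lemma collapse_mapP x y : p x = p y <-> x = y \/ exists i, A i x /\ A i y.
Proof. by split => [/eqmodP/asboolP//|xy]; apply/eqmodP/asboolP. Qed.

Lemma collapse_reprK (y : Y) : p (repr y) = y.
Proof. exact: reprK. Qed.

Lemma A_closed i : closed (A i).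
Proof. by apply: compact_closed => //; exact: metric_hausdorff. Qed.

Lemma in_A_inj i j x : A i x -> A j x -> i = j.
Proof. by move=> Aix Ajx; apply: disjA => //; exists x. Qed.

(** The image of [O] is written with representatives; saturation makes its preimage equal to [O]. *)
Lemma open_collapse (O : set X) : open O ->
  (forall x y, p x = p y -> O x -> O y) -> open [set y : Y | O (repr y)].
Proof.
move=> oO satO; rewrite /open/= /quotient_open (_ : _ @^-1` _ = O)//.
apply/seteqP; split => x /=.
  by apply: satO; exact: collapse_reprK.
by apply: satO; rewrite collapse_reprK.
Qed.

Definition outside : set X := [set x | forall i, ~ A i x].

Lemma open_outside : open outside.
Proof.
rewrite (_ : outside = ~` \bigcup_(i in [set: 'I_n]) A i).
  by rewrite openC; apply: closed_bigcup => [|i _]; [exact: finite_finset|exact: A_closed].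
by apply/seteqP; split => [x Ox [i _]|x Ox i Aix]; [exact: Ox|apply: Ox; exists i].
Qed.

Lemma collapse_outside x y : outside x -> p x = p y -> x = y.
Proof. by move=> Ox /collapse_mapP[//|[i [/Ox]]]. Qed.

(** Removing the other sets [A j] makes this neighborhood of [A i] saturated. *)
Definition around i e : set X :=
  [set x | dist i x < e /\ forall j, j != i -> ~ A j x].

Lemma open_around i e : A i !=set0 -> open (around i e).
Proof.
move=> Ai0; rewrite (_ : around i e =
    [set x | dist i x < e] `&` ~` \bigcup_(j in [set j | j != i]) A j).
  apply: openI; first exact: open_set_dist_lt.
  by rewrite openC; apply: closed_bigcup => [|j _]; [exact: finite_finset|exact: A_closed].
apply/seteqP; split => x [xe xA]; split => //; first by move=> [j /xA].
by move=> j ji Ajx; apply: xA; exists j.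
Qed.

Lemma around_sat i e x y : A i !=set0 -> p x = p y -> around i e x -> around i e y.
Proof.
move=> Ai0 /collapse_mapP[<-//|[k [Akx Aky]]] [xe xj].
have [ki|/xj//] := eqVneq k i; rewrite ki in Aky.
split; first by rewrite set_dist_mem//; apply: le_lt_trans xe; exact: set_dist_ge0.
by move=> j ji Ajy; move: ji; rewrite (in_A_inj Ajy Aky) eqxx.
Qed.

Lemma around_notin i e x : around i e x -> ~ A i x -> outside x.
Proof. by move=> [_ xj] nAix j; have [->|/xj] := eqVneq j i. Qed.

Lemma mem_around i e x : 0 < e -> A i x -> around i e x.
Proof.
move=> e0 Aix; split; first by rewrite set_dist_mem//; exists x.
by move=> j ji Ajx; move: ji; rewrite (in_A_inj Ajx Aix) eqxx.
Qed.

Section lift.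
Context (a : R -> Y) (ca : continuous a).
Local Notation w := (fun s => repr (a s) : X).

(** The lift by representatives may jump inside a collapsed set, but a saturated open set does not
    see this, since it comes from an open set of the quotient. *)
Lemma lift_near (O : set X) s : open O -> (forall x y, p x = p y -> O x -> O y) ->
  O (w s) -> \forall u \near s, O (w u).
Proof.
move=> oO satO Os.
have : nbhs (a s) [set y : Y | O (repr y)].
  by apply: open_nbhs_nbhs; split => //; exact: open_collapse.
exact: ca.
Qed.

(** The collapse map is injective off the sets [A i], so every subset of [outside] is saturated. *)
Lemma lift_continuous s : outside (w s) -> w @ s --> w s.
Proof.
move=> Os W; rewrite nbhsE => -[Q [oQ Qws] QW].
have : \forall u \near s, (Q `&` outside) (w u).
  apply: lift_near; [by apply: openI => //; exact: open_outside| |by []].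
  by move=> x y xy [Qx xo]; rewrite -(collapse_outside xo xy).
by apply: filterS => u [/QW].
Qed.

Lemma lift_dist_continuous i : A i !=set0 -> (forall s, exists e, around i e (w s)) ->
  continuous (fun s => dist i (w s)).
Proof.
move=> Ai0 wi s; have [Ais|nAis] := pselect (A i (w s)).
  apply/cvgrPdist_lt => e e0; rewrite set_dist_mem//.
  have := @lift_near (around i e) s (open_around e Ai0) (fun x y => around_sat Ai0).
  move=> /(_ (mem_around e0 Ais)); apply: filterS => u [ue _].
  by rewrite sub0r normrN ger0_norm//; exact: set_dist_ge0.
have [e we] := wi s.
apply: (@continuous_comp _ _ _ w (set_dist (A i))).
  exact: lift_continuous (around_notin we nAis).
apply/cvgrPdist_lt => r r0; apply/nbhs_ballP; exists r => //= y /in_ball sy.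
have := set_dist_triangle Ai0 (w s) y; have := set_dist_triangle Ai0 y (w s).
by rewrite (metric_sym y) ltr_norml => ? ?; apply/andP; split; lra.
Qed.

End lift.

(** The preimage of a neighborhood of the collapsed point contains a uniform tube around [A i], by
    compactness. *)
Lemma collapse_star_nbhs i x0 (W : set Y) : A i x0 -> nbhs (p x0) W ->
  exists2 e, 0 < e & forall x, dist i x < e -> W (p x).
Proof.
move=> Ax0; rewrite nbhsE => -[Q [oQ Qx0] QW].
have oQ' : open (p @^-1` Q) by apply: open_comp => // ? _; exact: collapse_map_continuous.
have [|||r r0 rP] := @compact_uniform R X (A i) (fun V _ => V `<=` p @^-1` Q) 1 (A_compact (i := i)).
- by [].
- by move=> V V' U U' V'V _; exact: subset_trans.
- move=> x Ax; have : nbhs x (p @^-1` Q).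
    apply: open_nbhs_nbhs; split => //=.
    by rewrite (_ : p x = p x0)//; apply/collapse_mapP; right; exists i.
  by move=> /nbhs_ballP[r /= r0 rQ]; exists r.
have A0 : A i !=set0 by exists x0.
exists r => // x /(set_dist_lt A0)[b Ab xb]; apply: QW; apply: (rP _ Ab).
by apply/in_ball; rewrite metric_sym.
Qed.

(** Lifts a vertical side of the deformation, starting at the prescribed [x]. In [A i] the side is
    constant and lifts to [x]; off [A i] the representative is [x] itself, and the side is the image
    of its chosen path. *)
Lemma lift_side i x0 (g : X -> R -> X) (a : R -> Y) s x (d : R -> Y) e :
  A i x0 -> around i e (repr (a s)) -> (~ A i (repr (a s)) -> joins (A i) g (repr (a s)) 1) ->
  (A i (repr (a s)) -> forall t, d t = p x0) ->
  (~ A i (repr (a s)) -> forall t, d t = p (g (repr (a s)) (2 * t - 1))) ->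
  p x = a s -> exists c b, [/\ path_in setT x b c, A i b & forall t, d t = p (c t)].
Proof.
move=> Ax0 ai gj dA dg pxa; have [Ai|nAi] := pselect (A i (repr (a s))).
  have Aix : A i x.
    have /collapse_mapP[<-//|[k [Ak Akx]]] : p (repr (a s)) = p x by rewrite collapse_reprK.
    by rewrite (in_A_inj Ai Ak).
  exists (fun=> x), x; split => //; first exact: path_in_cst.
  by move=> t; rewrite dA//; apply/collapse_mapP; right; exists i.
have <- : repr (a s) = x.
  by apply: collapse_outside (around_notin ai nAi) _; rewrite collapse_reprK.
have [b Ab gP] := gj nAi; exists (fun t => g (repr (a s)) (2 * t - 1)), b; split => //.
  by apply: path_in_delay; exact: path_in_sub gP.
exact: dg.
Qed.

Lemma around_homotopic_to_lift i : A i !=set0 -> exists2 e, 0 < e &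
  forall a : R -> Y, continuous a -> (forall s, around i e (repr (a s))) ->
  forall x y, p x = a 0 -> p y = a 1 -> homotopic_to_lift p a 0 1 x y.
Proof.
move=> Ai0; have [x0 Ax0] := Ai0.
have [g gP] := joins_modulus Ai0 X1 (A_lpc (i := i)) (A_compact (i := i)).
have [K KP] := fillings_modulus Ai0 X1 (A_lpc (i := i)) (A_compact (i := i)) gP.
have [r1 r10 r1P] := KP _ (@ltr01 R).
have [r2 r20 r2P] := gP _ (@ltr01 R).
(* Below [r1] fillings exist, below [r2] joining paths; any positive bound in place of 1 would
   do. *)
exists (Num.min r1 r2); first by rewrite lt_min r10.
move=> a ca wi x y px py; pose w s : X := repr (a s).
have w1 s : dist i (w s) < r1 by have [] := wi s; rewrite lt_min => /andP[].
have w2 s : dist i (w s) < r2 by have [] := wi s; rewrite lt_min => /andP[].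
have wj s : ~ A i (w s) -> joins (A i) g (w s) 1.
  by move=> nA; apply: r2P => //; apply: set_dist_gt0 => //; exact: A_closed.
have wc s : ~ A i (w s) -> w @ s --> w s.
  by move=> nA; apply: lift_continuous => //; exact: around_notin (wi s) nA.
have wd : continuous (fun s => dist i (w s)).
  by apply: lift_dist_continuous => // s; exists (Num.min r1 r2).
have pA z : A i z -> p z = p x0.
  by move=> Az; apply/collapse_mapP; right; exists i.
have cp : continuous p by exact: collapse_map_continuous.
have ns W := @collapse_star_nbhs i x0 W Ax0.
have Ac := @A_closed i.
pose D := deformation (A i) p (p x0) K w.
have cD : continuous D by exact: (deformation_continuous Ai0 Ac cp pA ns KP r1P w1 wc wd).
have D0 s : D (s, 0) = a s.
  by rewrite -[RHS]collapse_reprK; exact: (deformation0 Ai0 Ac cp pA r1P w1 wc).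
have D1 s : D (s, 1) = p x0 by exact: (deformation1 Ai0 Ac cp pA r1P w1 wc).
have [||c [b [cP Ab Dc]]] := lift_side (d := fun t => D (0, t)) Ax0 (wi 0) (@wj 0) _ _ px.
- by move=> Aw t; exact: deformation_star.
- by move=> Aw t; exact: (deformation_left Ai0 Ac cp pA r1P w1 wc).
have [||c' [b' [cP' Ab' Dc']]] := lift_side (d := fun t => D (1, t)) Ax0 (wi 1) (@wj 1) _ _ py.
- by move=> Aw t; exact: deformation_star.
- by move=> Aw t; exact: (deformation_right Ai0 Ac cp pA r1P w1 wc).
have [m mP] := connected_lpc_joined (A_connected (i := i)) (A_lpc (i := i)) Ab Ab'.
exact: homotopic_to_lift_square cD D0 D1 pA cP cP' mP Dc Dc'.
Qed.

(** The lift by representatives is continuous here, and the homotopy is constant. *)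
Lemma outside_homotopic_to_lift (a : R -> Y) x y : continuous a ->
  (forall s, outside (repr (a s))) -> p x = a 0 -> p y = a 1 ->
  homotopic_to_lift p a 0 1 x y.
Proof.
move=> ca ao px py; exists (fun s => repr (a s)), (fun q => a q.1); split => //=.
- by move=> s; exact: lift_continuous.
- by split; apply: collapse_outside => //; rewrite collapse_reprK.
- by apply: comp_continuous ca; exact: fst_continuous.
- by move=> s _; rewrite collapse_reprK.
Qed.

Lemma path_homotopic_to_lift (a : R -> Y) x y : continuous a ->
  p x = a 0 -> p y = a 1 -> homotopic_to_lift p a 0 1 x y.
Proof.
move=> ca; move: x y; apply: (@interval_induction R (fun u v =>
  forall x y, p x = a u -> p y = a v -> homotopic_to_lift p a u v x y)).
- move=> u v z uv vz uvP vzP x y px py.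
  (* Both lifts are made to meet at the representative of [a v]. *)
  apply: (@homotopic_to_lift_cat _ _ _ _ _ _ v _ _ (repr (a v))); rewrite ?ltW//.
    by apply: uvP => //; exact: collapse_reprK.
  by apply: vzP => //; exact: collapse_reprK.
move=> s _.
(* By continuity a short piece of [a] around [s] has its representatives in [O]; rescaled to the
   unit interval, it falls under the lifting result for [O]. *)
have step (O : set X) : open O -> (forall x y, p x = p y -> O x -> O y) ->
    O (repr (a s)) ->
    (forall a : R -> Y, continuous a -> (forall s, O (repr (a s))) ->
      forall x y, p x = a 0 -> p y = a 1 -> homotopic_to_lift p a 0 1 x y) ->
  exists2 d, 0 < d & forall u v, s - d < u -> u < v -> v < s + d ->
    forall x y, p x = a u -> p y = a v -> homotopic_to_lift p a u v x y.
  move=> oO satO Os OP; have := lift_near ca oO satO Os.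
  move=> /nbhs_ballP[d /= d0 dP]; exists d => // u v su uv vs x y px py.
  apply: homotopic_to_lift_rescale => //; apply: OP.
  - apply: comp_continuous ca; apply: continuous_addr; first exact: continuous_cstr.
    apply: continuous_mulr; first exact: continuous_cstr.
    by apply: continuous_clamp => ?; exact: cvg_id.
  - move=> t; apply: dP; rewrite /ball/= ltr_norml.
    have := clamp_ge0 t; have := clamp_le1 t => t1 t0.
    by apply/andP; split; nra.
  - by rewrite clamp0 mulr0 addr0.
  - by rewrite clamp1 mulr1 addrC subrK.
have [[i Ai]|nA] := pselect (exists i, A i (repr (a s))).
  have Ai0 : A i !=set0 by exists (repr (a s)).
  have [e e0 eP] := around_homotopic_to_lift Ai0.
  apply: (step (around i e)) => //; first exact: open_around.
    by move=> ? ?; exact: around_sat.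
  exact: mem_around.
apply: (step outside) => //.
- exact: open_outside.
- by move=> ? ? + xo; move=> /(collapse_outside xo) <-.
- by move=> i Ai; apply: nA; exists i.
- by move=> b cb bo ? ?; exact: outside_homotopic_to_lift.
Qed.

End collapse_lifting.

(** * Surjectivity on fundamental groups *)

Theorem theoremB (R : realType) (X : metricType R) (n : nat)
    (A : 'I_n -> set X) (disjA : trivIset [set: 'I_n] A)
    (X_loc1c : locally_1connected R X)
    (A_connected : forall i, connected (A i))
    (A_lpc : forall i, locally_path_connected R (set_type (A i)))
    (A_compact : forall i, compact (A i))
    (a : X) (aA : (\bigcup_(i in [set: 'I_n]) A i) a) :
  let p : continuousType X (collapse disjA) := collapse_map disjA in
  let p_star : pi1qtop R a -> pi1qtop R (p a) := pi1_map p a in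
  [/\ continuous p_star,
      {morph p_star : b c / (b * c)%g}
    & set_surj [set: pi1qtop R a] [set: pi1qtop R (p a)] p_star].
Proof.
move=> p p_star; split; [exact: pi1_map_continuous|exact: pi1_mapM|].
move=> c _; rewrite -[c]reprK; move: (repr c) => f.
have cf : continuous (fun s : R => f (clampI s)).
  by apply: comp_continuous; [exact: clampI_continuous|exact: cts_fun].
(* Both ends of the lift are prescribed to be [a], so [b] gives a loop even though [p a] has other
   preimages in general. *)
have [||b [H [cb [b0 b1] cH Hs He]]] :=
  path_homotopic_to_lift X_loc1c A_connected A_lpc A_compact (x := a) (y := a) cf.
- by rewrite clampI0 path_zero.
- by rewrite clampI1 path_one.
have ch : continuous (fun s : unitI R => b (unitI_val s)).
  by apply: comp_continuous cb; exact: unitI_val_continuous.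
have h0 : b (unitI_val (zero : unitI R)) = a by rewrite unitI_val0.
have h1 : b (unitI_val (one : unitI R)) = a by rewrite unitI_val1.
pose h : pathI R a a := mk_path ch h0 h1.
exists (\pi_(pi1qtop R a) h) => //.
rewrite [LHS]pi1_mapE; apply/pi1_eqP; apply: homotopic_sym.
exists (fun q => H (unitI_val q.1, unitI_val q.2)); split => //=.
- apply: comp_continuous cH; apply: pair_continuous; apply: unitI_val_comp_continuous.
    exact: fst_continuous.
  exact: snd_continuous.
- move=> s; rewrite unitI_val0 (Hs _ _).1 ?unitI_valK//.
  by rewrite unitI_val_ge0 unitI_val_le1.
- move=> s; rewrite unitI_val1 (Hs _ _).2//.
  by rewrite unitI_val_ge0 unitI_val_le1.
- move=> t; rewrite unitI_val0 unitI_val1 (He _).1 (He _).2.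
  by rewrite clampI0 clampI1 path_zero path_one.
Qed.
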